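(* Let $\Omega$ be a compact metric space and $\varphi:\Omega\to\Omega$ a continuous map such that $(\Omega,\varphi)$ is tame. Then there exists an ergodic operator sequence in $\mathcal{L}(X^* )$ converging in the $\mathrm{W^*O}$-topology, and the following are equivalent: (a) every ergodic operator net in $\mathcal{L}(X^* )$ converges in the $\mathrm{W^*O}$-topology; (b) for every $\omega\in\Omega$ the subsystem $(\overline{o}(\omega),\varphi)$ is uniquely ergodic; (c) every ergodic operator sequence in $\mathcal{L}(X^* )$ converges in the $\mathrm{W^*O}$-topology; (d) for every $\omega\in\Omega$ the orbit closure $\overline{o}(\omega)$ contains exactly one minimal set.
   Context: $X=C(\Omega)$ with sup norm, $X^*$ the space of Radon measures, pairing $(x,\mu)$. $Ux=x\circ\varphi$, $V=U^*$. The $\mathrm{W^*O}$-topology on $\mathcal{L}(X^* )$: $T_\alpha\to T$ iff $(x,T_\alpha\mu)\to(x,T\mu)$ for all $x,\mu$. A net (or sequence) $\{V_\alpha\}\subseteq\operatorname{co}\{V^n:n\in\mathbb{N}_0\}$ is ergodic if $(x,(\operatorname{Id}-V)V_\alpha\mu)\to0$ for all $x\in X,\mu\in X^*$. $\overline{o}(\omega)$ is the closure of $\{\varphi^n\omega:n\ge0\}$; a minimal set is a nonempty closed $\varphi$-invariant set with no proper such subset. The system $(\Omega,\varphi)$ is tame if for every $x\in X$ and every strictly increasing sequence $\{n(k)\}\subseteq\mathbb{N}_0$, $\inf_a\|\sum_k a_k\,x\circ\varphi^{n(k)}\|_X=0$, the infimum over finitely supported scalar sequences with $\sum_k|a_k|=1$.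 *)

(* Defs.v *)
From HB Require Import structures.
From mathcomp Require Import all_boot all_order all_algebra.
From mathcomp Require Import all_classical all_reals all_analysis.
Set Implicit Arguments. Unset Strict Implicit. Unset Printing Implicit Defensive.
Import Order.TTheory GRing.Theory Num.Theory.
Import numFieldNormedType.Exports.
Local Open Scope classical_set_scope.
Local Open Scope ring_scope.

Section Defs.
Variables (R : realType) (T : topologicalType).

Definition inX (x : T -> R) : Prop := continuous x.
Definition supnorm (x : T -> R) : R := sup [set `|x t| | t in [set: T]].

Definition inXstar (mu : (T -> R) -> R) : Prop :=
  (forall (a : R) (x y : T -> R), inX x -> inX y ->
      mu (fun t => a * x t + y t) = a * mu x + mu y) /\
  (exists M : R, forall x, inX x -> `|mu x| <= M * supnorm x).

Definition inLXstar (A : ((T -> R) -> R) -> ((T -> R) -> R)) : Prop :=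
  (forall mu, inXstar mu -> inXstar (A mu)) /\
  (forall (a : R) mu nu, inXstar mu -> inXstar nu -> forall x, inX x ->
      A (fun z => a * mu z + nu z) x = a * A mu x + A nu x) /\
  (exists M : R, forall mu (c : R), inXstar mu -> 0 <= c ->
      (forall x, inX x -> `|mu x| <= c * supnorm x) ->
      (forall x, inX x -> `|A mu x| <= M * c * supnorm x)).

Variable phi : T -> T.

Definition Vop (mu : (T -> R) -> R) : (T -> R) -> R := fun x => mu (x \o phi).

Definition in_coV (A : ((T -> R) -> R) -> ((T -> R) -> R)) : Prop :=
  exists (N : nat) (c : nat -> R),
    (forall n, 0 <= c n) /\ \sum_(n < N) c n = 1 /\
    forall mu, inXstar mu -> forall x, inX x ->
      A mu x = \sum_(n < N) c n * (iter n Vop mu) x.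

Definition directed (D : Type) (le : D -> D -> Prop) : Prop :=
  (forall i, le i i) /\ (forall i j k, le i j -> le j k -> le i k) /\
  (exists i : D, True) /\ (forall i j, exists k, le i k /\ le j k).

Definition net_cvg (D : Type) (le : D -> D -> Prop) (r : D -> R) (l : R) : Prop :=
  forall e : R, 0 < e -> exists i0, forall i, le i0 i -> `|r i - l| < e.

Definition ergodic_net (D : Type) (le : D -> D -> Prop)
    (Va : D -> ((T -> R) -> R) -> ((T -> R) -> R)) : Prop :=
  (forall i, in_coV (Va i)) /\
  forall x mu, inX x -> inXstar mu ->
    net_cvg le (fun i => Va i mu x - Vop (Va i mu) x) 0.

Definition WSO_cvg (D : Type) (le : D -> D -> Prop)
    (Va : D -> ((T -> R) -> R) -> ((T -> R) -> R)) : Prop :=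
  exists A, inLXstar A /\
    forall x mu, inX x -> inXstar mu -> net_cvg le (fun i => Va i mu x) (A mu x).

(** Tameness. Finitely supported (a_k) with sum |a_k| = 1 are encoded as
    a : nat -> R together with a bound N on the support. *)
Definition tame : Prop :=
  forall x, inX x -> forall n : nat -> nat, (forall k, (n k < n k.+1)%N) ->
    inf [set r | exists (N : nat) (a : nat -> R),
           \sum_(k < N) `|a k| = 1 /\
           r = supnorm (fun t => \sum_(k < N) a k * x (iter (n k) phi t))] = 0.

Definition orbit_closure (w : T) : set T := closure (range (fun n => iter n phi w)).

Definition invariant_set (M : set T) : Prop := phi @` M `<=` M.
Definition minimal_set (M : set T) : Prop :=
  M !=set0 /\ closed M /\ invariant_set M /\
  forall M', M' `<=` M -> M' !=set0 -> closed M' -> invariant_set M' -> M' = M.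

(** phi-invariant probability (Radon) measures on a closed invariant K,
    viewed as elements of X^star supported in K. *)
Definition inv_prob_on (K : set T) (mu : (T -> R) -> R) : Prop :=
  inXstar mu /\
  (forall x, inX x -> (forall t, 0 <= x t) -> 0 <= mu x) /\
  mu (fun _ => 1) = 1 /\
  (forall x, inX x -> (forall t, K t -> x t = 0) -> mu x = 0) /\
  (forall x, inX x -> Vop mu x = mu x).

Definition uniquely_ergodic_on (K : set T) : Prop :=
  (exists mu, inv_prob_on K mu) /\
  forall mu nu, inv_prob_on K mu -> inv_prob_on K nu ->
    forall x, inX x -> mu x = nu x.

End Defs.

(* Main.v *)
(* Write x_n for x composed with the n-th iterate of phi, and let L range over
   positive functionals on C(Omega).

   Tameness forbids independence of ({x_n > b}, {x_n < a}) along a subsequence,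
   so by Rosenthal's dichotomy every subsequence of (x_n) has a pointwise
   convergent one, and bounded convergence makes {x_n} totally bounded for each
   seminorm L|.|.  Total boundedness passes to convex hulls, and an independent
   sequence in the hull would be uniformly separated in L|.| for L a limit of
   averages over its cells.  Hence the hull contains no independent sequence
   either, which has two consequences.  Some subsequence of the Cesaro means
   converges pointwise for all x, hence in the weak* operator topology.  And
   bounded convergence holds for nets in the hull: if w_i -> 0 pointwise but
   L|w_i| does not tend to 0, an independent sequence can be extracted.

   The latter gives (b) => (a), since the Dirac functionals determine the limit.
   It also gives (d) => (b): phi^n pushes any finite subset of an orbit closure
   K towards the only minimal set M of K, so every invariant measure on K lives
   on M, where the limit of Cesaro means is an invariant function; two values of
   it would be taken on dense orbits and produce independence.  For (c) => (b),
   the means over shifted windows of the orbit come near both of two distinct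
   invariant measures, and interlacing yields a divergent ergodic sequence.
   Disjoint minimal sets carry distinct invariant measures, so (b) => (d). *)
Require Import Defs.
From HB Require Import structures.
From mathcomp Require Import all_boot all_order all_algebra.
From mathcomp Require Import all_classical all_reals all_analysis.
From mathcomp Require Import ring lra.
Import Order.TTheory GRing.Theory Num.Theory.
Import numFieldNormedType.Exports.
Local Open Scope classical_set_scope.
Local Open Scope ring_scope.

Set Implicit Arguments. Unset Strict Implicit. Unset Printing Implicit Defensive.

(** * The cone of nonnegative continuous functions and its positive functionals *)

Section PositiveFunctionals.
Variables (R : realType) (T : topologicalType).
Implicit Types (x y z : T -> R) (L : (T -> R) -> R).

Lemma inX_cst (a : R) : inX (fun _ : T => a).
Proof. by move=> t; exact: cvg_cst. Qed.

Lemma inX_add x y : inX x -> inX y -> inX (fun t => x t + y t).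
Proof. by move=> hx hy t; exact: cvgD (hx t) (hy t). Qed.

Lemma inX_mul x y : inX x -> inX y -> inX (fun t => x t * y t).
Proof. by move=> hx hy t; exact: cvgM (hx t) (hy t). Qed.

Lemma inX_scale (a : R) x : inX x -> inX (fun t => a * x t).
Proof. by move=> hx; apply: inX_mul => //; exact: inX_cst. Qed.

Lemma inX_opp x : inX x -> inX (fun t => - x t).
Proof. by move=> hx t; exact: cvgN (hx t). Qed.

Lemma inX_sub x y : inX x -> inX y -> inX (fun t => x t - y t).
Proof. by move=> hx hy t; exact: cvgB (hx t) (hy t). Qed.

Lemma inX_abs x : inX x -> inX (fun t => `|x t|).
Proof. by move=> hx t; exact: cvg_norm (hx t). Qed.

Lemma inX_max x y : inX x -> inX y -> inX (fun t => Num.max (x t) (y t)).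
Proof. by move=> hx hy t; exact: continuous_max (hx t) (hy t). Qed.

Lemma inX_min x y : inX x -> inX y -> inX (fun t => Num.min (x t) (y t)).
Proof. by move=> hx hy t; exact: continuous_min (hx t) (hy t). Qed.

Lemma inX_sum (n : nat) (f : nat -> T -> R) :
  (forall k, inX (f k)) -> inX (fun t => \sum_(k < n) f k t).
Proof.
move=> hf; elim: n => [|n IH].
  have -> : (fun t => \sum_(k < 0) f k t) = fun _ => 0.
    by apply/funext => t; rewrite big_ord0.
  exact: inX_cst.
have -> : (fun t => \sum_(k < n.+1) f k t) =
          (fun t => \sum_(k < n) f k t + f n t).
  by apply/funext => t; rewrite big_ord_recr.
exact: inX_add.
Qed.

Lemma inX_comp (g : T -> T) x : continuous g -> inX x -> inX (x \o g).
Proof. by move=> hg hx t; apply: continuous_comp; [exact: hg|exact: hx]. Qed.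

Lemma open_gt x (a : R) : inX x -> open [set t | a < x t].
Proof. by move=> hx; apply: open_comp (@open_gt _ a) => ? _; exact: hx. Qed.

Lemma open_lt x (a : R) : inX x -> open [set t | x t < a].
Proof. by move=> hx; apply: open_comp (@open_lt _ a) => ? _; exact: hx. Qed.

Lemma closed_ge x (a : R) : inX x -> closed [set t | a <= x t].
Proof. by move=> hx; apply: closed_comp (@closed_ge _ a) => ? _; exact: hx. Qed.

Definition cpos x := inX x /\ forall t, 0 <= x t.

Lemma cpos_cst (a : R) : 0 <= a -> cpos (fun _ => a).
Proof. by split=> //; exact: inX_cst. Qed.

Lemma cpos_add x y : cpos x -> cpos y -> cpos (fun t => x t + y t).
Proof.
by move=> [cx x0] [cy y0]; split=> [|t]; [exact: inX_add|exact: addr_ge0].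
Qed.

Lemma cpos_mul x y : cpos x -> cpos y -> cpos (fun t => x t * y t).
Proof.
by move=> [cx x0] [cy y0]; split=> [|t]; [exact: inX_mul|exact: mulr_ge0].
Qed.

Lemma cpos_scale (a : R) x : 0 <= a -> cpos x -> cpos (fun t => a * x t).
Proof. by move=> a0 hx; apply: cpos_mul => //; exact: cpos_cst. Qed.

Lemma cpos_abs x : inX x -> cpos (fun t => `|x t|).
Proof. by move=> hx; split=> //; exact: inX_abs. Qed.

Lemma cpos_max x y : cpos x -> inX y -> cpos (fun t => Num.max (x t) (y t)).
Proof.
by move=> [cx x0] cy; split=> [|t]; [exact: inX_max|rewrite le_max x0].
Qed.

Lemma cpos_min x y : cpos x -> cpos y -> cpos (fun t => Num.min (x t) (y t)).
Proof.
by move=> [cx x0] [cy y0]; split=> [|t]; [exact: inX_min|rewrite le_min x0 y0].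
Qed.

Lemma cpos_pospart x (b : R) : inX x -> cpos (fun t => Num.max 0 (x t - b)).
Proof.
move=> cx; apply: cpos_max; first exact: cpos_cst.
by apply: inX_sub => //; exact: inX_cst.
Qed.

Lemma cpos_sum (n : nat) (f : nat -> T -> R) :
  (forall k, cpos (f k)) -> cpos (fun t => \sum_(k < n) f k t).
Proof.
move=> hf; split=> [|t]; first by apply: inX_sum => k; case: (hf k).
by apply: sumr_ge0 => k _; case: (hf k).
Qed.

(** Only the cone is constrained: total variations arise as suprema that make sense there, and
    nothing is asked of their values elsewhere. *)
Definition posf L :=
  [/\ forall x y, cpos x -> cpos y -> L (fun t => x t + y t) = L x + L y,
      forall a x, 0 <= a -> cpos x -> L (fun t => a * x t) = a * L x &
      forall x, cpos x -> 0 <= L x].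

Section Posf.
Variable L : (T -> R) -> R.
Hypothesis hL : posf L.

Lemma posf_le x y : cpos x -> cpos y -> (forall t, x t <= y t) -> L x <= L y.
Proof.
case: hL => LD _ L0 hx hy xy.
have hd : cpos (fun t => y t - x t).
  by split=> [|t]; [apply: inX_sub; [case: hy|case: hx]|rewrite subr_ge0].
have -> : y = fun t => x t + (y t - x t) by apply/funext => t; rewrite subrKC.
by rewrite LD// lerDl L0.
Qed.

Lemma posf_bound x (c : R) : 0 <= c -> cpos x -> (forall t, x t <= c) ->
  L x <= c * L (fun _ => 1).
Proof.
move=> c0 hx xc; case: (hL) => _ LZ _.
have h1 : cpos (fun _ => 1) by exact: cpos_cst.
rewrite -LZ//; apply: posf_le => //; first exact: cpos_scale.
by move=> t; rewrite mulr1.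
Qed.

Lemma posf0 : L (fun _ => 0) = 0.
Proof.
case: (hL) => _ LZ _; rewrite -[RHS](mul0r (L (fun _ => 0))).
rewrite -LZ//; last exact: cpos_cst.
by congr L; apply/funext => t; rewrite mul0r.
Qed.

Lemma posf_sum (n : nat) (f : nat -> T -> R) : (forall k, cpos (f k)) ->
  L (fun t => \sum_(k < n) f k t) = \sum_(k < n) L (f k).
Proof.
case: (hL) => LD _ _ hf; elim: n => [|n IH].
  rewrite big_ord0 -[RHS]posf0; congr L; apply/funext => t.
  by rewrite big_ord0.
have -> : (fun t => \sum_(k < n.+1) f k t) =
          (fun t => \sum_(k < n) f k t + f n t).
  by apply/funext => t; rewrite big_ord_recr.
by rewrite LD// ?big_ord_recr ?IH//; exact: cpos_sum.
Qed.

Lemma posf_dist_triangle x y z : inX x -> inX y -> inX z ->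
  L (fun t => `|x t - z t|) <= L (fun t => `|x t - y t|) + L (fun t => `|y t - z t|).
Proof.
case: (hL) => LD _ _ hx hy hz.
have dpos u v : inX u -> inX v -> cpos (fun t => `|u t - v t|).
  by move=> hu hv; apply: cpos_abs; exact: inX_sub.
rewrite -LD; [|exact: dpos|exact: dpos].
apply: posf_le; [exact: dpos|by apply: cpos_add; exact: dpos|].
by move=> t; exact: ler_distD.
Qed.

End Posf.
End PositiveFunctionals.

(** * Finite covers, Dini's theorem and bounded convergence on a compact space *)

Section Compact.
Variables (R : realType) (T : topologicalType).
Hypothesis hT : compact [set: T].
Implicit Types (x y z : T -> R) (L : (T -> R) -> R).

(** If no finite subfamily covered, the complements of finite unions would generate a proper filter,
    and a cluster point [p] of it would contradict [O p]. *)
Lemma compact_seq_cover (O : T -> set T) :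
  (forall t, open (O t)) -> (forall t, O t t) ->
  exists l : seq T, forall s, exists2 t, t \in l & O t s.
Proof.
move=> oO Ot; apply: contrapT => nocov.
pose F : set_system T := fun A =>
  exists l : seq T, forall s, (forall t, t \in l -> ~ O t s) -> A s.
have FF : ProperFilter F.
  split.
    move=> [l hl]; apply: nocov; exists l => s; apply: contrapT => hs.
    by apply: (hl s) => t tl Ots; apply: hs; exists t.
  split; first by exists [::].
  - move=> A B [l hl] [k hk]; exists (l ++ k) => s hs; split.
      by apply: hl => t tl; apply: hs; rewrite mem_cat tl.
    by apply: hk => t tl; apply: hs; rewrite mem_cat tl orbT.
  - by move=> A B AB [l hl]; exists l => s /hl /AB.
have [p [_ clp]] := hT FF filterT.
have FO : F (~` O p) by exists [:: p] => s hs; apply: hs; rewrite inE.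
by have [q []] := clp _ _ FO (open_nbhs_nbhs (conj (oO p) (Ot p))).
Qed.

Lemma inX_bounded x : inX x -> exists2 M : R, 0 <= M & forall t, `|x t| <= M.
Proof.
move=> cx.
have [||l hl] := @compact_seq_cover (fun t => [set s | `|x s| < `|x t| + 1]).
- by move=> t; exact: open_lt (inX_abs cx).
- by move=> t /=; rewrite ltrDl.
exists (\sum_(t <- l) (`|x t| + 1)) => [|s]; first exact: sumr_ge0.
have [t tl /= /ltW st] := hl s; apply: le_trans st _.
by rewrite (big_rem t)//= lerDl sumr_ge0.
Qed.

Lemma dini (h : nat -> T -> R) : (forall n, inX (h n)) ->
  (forall n t, h n.+1 t <= h n t) ->
  (forall t e, 0 < e -> exists n, h n t < e) ->
  forall e, 0 < e -> exists n, forall t, h n t < e.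
Proof.
move=> ch hdec h0 e e0.
have hmono t : {homo (fun n => h n t) : m n / (m <= n)%N >-> n <= m}.
  by apply/nonincreasing_seqP => n; exact: hdec.
have [nt hnt] := choice (fun t => h0 t e e0).
have [l hl] := @compact_seq_cover (fun t => [set s | h (nt t) s < e])
  (fun t => open_lt _ (ch _)) hnt.
exists (\max_(t <- l) nt t)%N => s; have [t tl] := hl s.
by apply: le_lt_trans; apply: hmono; exact: leq_bigmax_seq.
Qed.

(* F. Riesz's proof of Arzela's theorem: near-optimal finite maxima [h n] of
   the tails have minima whose integrals stay away from 0, against Dini. *)
Lemma bounded_convergence L (g : nat -> T -> R) (M : R) : posf L ->
  (forall k, cpos (g k)) -> (forall k t, g k t <= M) ->
  (forall t e, 0 < e -> exists n, forall k, (n <= k)%N -> g k t < e) ->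
  forall e, 0 < e -> exists n, forall k, (n <= k)%N -> L (g k) < e.
Proof.
move=> hL cg gM g0 e e0; apply: contrapT => noe.
have big n : exists2 k, (n <= k)%N & e <= L (g k).
  apply: contrapT => hn; apply: noe; exists n => k nk.
  by rewrite ltNge; apply/negP => ek; apply: hn; exists k.
have [[t0]|T0] := pselect (exists t : T, True); last first.
  have [k _] := big 0%N; have -> : g k = fun t => 0 * g k t.
    by apply/funext => t; case: T0; exists t.
  by case: hL => _ -> //; rewrite mul0r leNgt e0.
have M0 : 0 <= M by apply: le_trans (gM 0%N t0); case: (cg 0%N).
(* [G n m] is the maximum of [g n], ..., [g (n + m)]. *)
pose G := fix G n m := if m is m'.+1 then
  (fun t => Num.max (G n m' t) (g (n + m)%N t)) else g n.
have cG n m : cpos (G n m).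
  by elim: m => [|m IH]; [exact: cg|apply: (cpos_max IH); case: (cg (n + m.+1)%N)].
have GM n m t : G n m t <= M.
  by elim: m => [|m IH] /=; rewrite ?ge_max ?IH gM.
have Gmono n t : {homo (fun m => G n m t) : a b / (a <= b)%N >-> a <= b}.
  by apply/nondecreasing_seqP => m /=; rewrite le_max lexx.
have gG n k t : (n <= k)%N -> g k t <= G n (k - n)%N t.
  move=> nk; case E : (k - n)%N => [|m] /=.
    by rewrite (_ : k = n)//; apply/eqP; rewrite eqn_leq nk -subn_eq0 E.
  by rewrite -E subnKC// le_max lexx orbT.
have GG n m t : G n.+1 m t <= G n m.+1 t.
  elim: m => [|m IH] /=; first by rewrite addn1 le_max lexx orbT.
  rewrite ge_max; apply/andP; split.
    by apply: le_trans IH _; exact: (Gmono n t _ _ (leqnSn m.+1)).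
  by rewrite addSnnS le_max lexx orbT.
have Gsmall n m t a : (forall k, (n <= k)%N -> g k t < a) -> G n m t < a.
  by move=> h; elim: m => [|m IH] /=; rewrite ?gt_max ?IH h// leq_addr.
(* [S n] stands for the integral of the supremum of the tail from [n]. *)
pose S n := sup [set L (G n m) | m in [set: nat]].
have hasS n : has_sup [set L (G n m) | m in [set: nat]].
  split; first by exists (L (G n 0%N)), 0%N.
  by exists (M * L (fun _ => 1)) => _ [m _ <-]; exact: posf_bound.
have leS n m : L (G n m) <= S n by apply: sup_upper_bound => //; exists m.
have Se n : e <= S n.
  have [k nk ek] := big n; apply: le_trans ek _.
  by apply: le_trans (leS n (k - n)%N); apply: posf_le => // t; exact: gG.
(* The tolerances halve at each step and sum to [e / 2], the total loss allowed to the running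
   minima [H]. *)
pose d n : R := e / 2 ^+ n.+2.
have d0 n : 0 < d n by rewrite divr_gt0// exprn_gt0.
have dS n : d n = d n.+1 + d n.+1.
  by rewrite /d [2 ^+ n.+3]exprS; field; rewrite expf_neq0.
have exm n : exists m, S n - d n < L (G n m).
  by have [_ [m _ <-]] := sup_adherent (d0 n) (hasS n); exists m.
have [m hm] := choice exm.
pose h n := G n (m n).
pose H := fix H n := if n is n'.+1 then
  (fun t => Num.min (H n' t) (h n t)) else h 0%N.
have cH n : cpos (H n) by elim: n => [|n IH]; [exact: cG|exact: (cpos_min IH (cG _ _))].
have Hh n t : H n t <= h n t by case: n => //= n; rewrite ge_min lexx orbT.
(* Induction through [min + max = H n + h n.+1]: the maximum is dominated by some [G n m], so its
   integral is at most [S n]. *)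
have LH n : S n - e / 2 + d n <= L (H n).
  elim: n => [|n IH].
    have := hm 0%N; rewrite -/(h 0%N) -/(H 0%N).
    have : e / 2 = d 0%N + d 0%N by rewrite /d; field.
    lra.
  have LD : L (fun t => Num.min (H n t) (h n.+1 t)) +
            L (fun t => Num.max (H n t) (h n.+1 t)) = L (H n) + L (h n.+1).
    have cmin := cpos_min (cH n) (cG n.+1 (m n.+1)).
    have cmax := cpos_max (cH n) (cG n.+1 (m n.+1)).1.
    case: (hL) => LD _ _; rewrite -(LD _ _ cmin cmax) -(LD _ _ (cH n) (cG _ _)).
    by congr L; apply/funext => t; rewrite addr_min_max.
  have -> : H n.+1 = fun t => Num.min (H n t) (h n.+1 t) by [].
  have : L (fun t => Num.max (H n t) (h n.+1 t)) <= S n.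
    apply: le_trans (leS n (maxn (m n) (m n.+1).+1)).
    apply: posf_le => //; first exact: (cpos_max (cH n) (cG _ _).1).
    move=> t; rewrite ge_max; apply/andP; split.
      by apply: le_trans (Hh _ _) _; apply: Gmono; exact: leq_maxl.
    by apply: le_trans (GG _ _ _) _; apply: Gmono; exact: leq_maxr.
  have := hm n.+1; have := dS n; rewrite -/(h n.+1).
  move: LD IH; move: (L _) (L _) (L _) (L _) => p q r s; lra.
(* Dini makes [L (H n)] at most [e / 4], while [LH] and [Se] keep it above [e / 2]. *)
have [|||n hn] := @dini H (fun n => (cH n).1) _ _ (e / (4 * (L (fun _ => 1) + 1))).
- by move=> n t /=; rewrite ge_min lexx.
- move=> t a a0; have [n hn] := g0 t a a0; exists n.
  by apply: le_lt_trans (Hh n t) _; exact: Gsmall.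
- by rewrite divr_gt0// mulr_gt0// ltr_wpDl//; case: hL => _ _; apply; exact: cpos_cst.
set l1 := L (fun _ => 1) in hn *.
have l10 : 0 <= l1 by case: hL => _ _; apply; exact: cpos_cst.
have c0 : 0 <= e / (4 * (l1 + 1)) by apply: divr_ge0; [exact: ltW|lra].
have := posf_bound hL c0 (cH n) (fun t => ltW (hn t)); rewrite -/l1 => hb.
have : L (H n) <= e / 4.
  apply: le_trans hb _; rewrite mulrAC ler_pdivrMr; last lra.
  have -> : e / 4 * (4 * (l1 + 1)) = e * l1 + e by field.
  by rewrite lerDl ltW.
by have := LH n; have := Se n; have := d0 n; lra.
Qed.

End Compact.

(** * Ultrafilters refining a filter, and ultralimits of bounded families *)

Section Ultralimits.
Variables (R : realType) (I : Type).
Implicit Types (F G : set_system I) (r : I -> R).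

Lemma ultra_frequently F (A : set I) : ProperFilter F ->
  (forall B, F B -> exists i, B i /\ A i) ->
  exists G, [/\ UltraFilter G, F `<=` G & G A].
Proof.
move=> FF hA; have wF : ProperFilter (within A F).
  split; last exact: within_filter.
  by rewrite /within => /= F0; have [i [Bi Ai]] := hA _ F0; exact: Bi Ai.
have [G [GU sG]] := ultraFilterLemma wF; exists G; split=> //.
  by move=> B FB; apply: sG; apply: filterS FB => i Bi _.
by apply: sG; rewrite /within/=; apply: filterS filterT.
Qed.

(** An error of at least [e] that recurs along [F] persists along some finer ultrafilter. *)
Lemma ultra_cvg F r (l : R) : ProperFilter F ->
  (forall G, UltraFilter G -> F `<=` G -> r @ G --> l) -> r @ F --> l.
Proof.
move=> FF h; apply/cvgrPdist_lt => e e0; apply: contrapT => ne.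
have [|G [GU FG GA]] := @ultra_frequently F [set i | e <= `|l - r i|] FF.
  move=> B FB; apply: contrapT => hB; apply: ne; apply: filterS FB => i Bi.
  by rewrite ltNge; apply/negP => ei; apply: hB; exists i.
have /cvgrPdist_lt/(_ e e0) Ge := h G GU FG.
have [i [/= ei]] := filter_ex (filterI GA Ge).
by rewrite ltNge ei.
Qed.

(** The limit is the supremum of the levels [a] with [a <= r i] for [F]-almost all [i]; maximality
    of [F] decides the upper estimate. *)
Lemma ultra_bounded_cvg F r (M : R) : UltraFilter F ->
  (forall i, `|r i| <= M) -> r @ F --> lim (r @ F).
Proof.
move=> UF rM; apply/cvg_ex.
pose E := [set a | F [set i | a <= r i]].
have hE : has_sup E.
  split; first by exists (- M); apply: filterS filterT => i _ /=; exact: lerNnormlW.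
  exists M => a Ea; have [i ai] := filter_ex Ea.
  by apply: le_trans ai _; exact: le_trans (ler_norm _) _.
exists (sup E); apply/cvgrPdist_lt => e e0.
have [a Ea ea] := sup_adherent e0 hE.
have Fu : F [set i | r i < sup E + e].
  have [//|Fn] := in_ultra_setVsetC [set i | r i < sup E + e] UF.
  have : E (sup E + e) by apply: filterS Fn => i /= /negP; rewrite -leNgt.
  by move/(sup_upper_bound hE); rewrite gerDl leNgt e0.
near=> i.
have h1 : a <= r i by near: i.
have h2 : r i < sup E + e by near: i.
rewrite ltr_norml; apply/andP; split; lra.
Unshelve. all: by end_near. Qed.

End Ultralimits.

(** * Bounded functionals on C(Omega) and their total variation *)

Section DualSpace.
Variables (R : realType) (T : topologicalType).
Hypothesis hT : compact [set: T].
Implicit Types (x y z : T -> R) (mu : (T -> R) -> R).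

Lemma supnorm_has_ubound x : inX x -> has_ubound [set `|x t| | t in [set: T]].
Proof. by move=> /(inX_bounded hT)[M _ xM]; exists M => _ [t _ <-]. Qed.

Lemma le_supnorm x t : inX x -> `|x t| <= supnorm x.
Proof. by move=> cx; apply: ub_le_sup; [exact: supnorm_has_ubound|exists t]. Qed.

Lemma supnorm_le x (c : R) : 0 <= c -> (forall t, `|x t| <= c) -> supnorm x <= c.
Proof.
move=> c0 xc; rewrite /supnorm; have [[t _]|T0] := pselect (exists t : T, True).
  by apply: ge_sup => [|_ [s _ <-]//]; exists `|x t|; exists t.
(* On the empty space this is the supremum of the empty set, 0 by convention. *)
rewrite (_ : [set _ | _ in _] = set0) ?sup0//.
by apply/seteqP; split=> // y [t _ _]; case: T0; exists t.
Qed.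

Lemma supnorm_ge0 x : inX x -> 0 <= supnorm x.
Proof.
move=> cx; have [[t _]|T0] := pselect (exists t : T, True).
  by apply: le_trans (le_supnorm t cx).
rewrite /supnorm (_ : [set _ | _ in _] = set0) ?sup0//.
by apply/seteqP; split=> // y [t _ _]; case: T0; exists t.
Qed.

Lemma inXstar_eval t : inXstar (fun x : T -> R => x t).
Proof.
split=> //; exists 1 => x cx; rewrite mul1r; exact: le_supnorm.
Qed.

Section Functional.
Variable mu : (T -> R) -> R.
Hypothesis hmu : inXstar mu.

Lemma inXstar_lin (a : R) x y : inX x -> inX y ->
  mu (fun t => a * x t + y t) = a * mu x + mu y.
Proof. by case: hmu => + _; apply. Qed.

Lemma inXstar_add x y : inX x -> inX y -> mu (fun t => x t + y t) = mu x + mu y.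
Proof.
move=> cx cy; rewrite -[mu x]mul1r -inXstar_lin//.
by congr mu; apply/funext => t; rewrite mul1r.
Qed.

Lemma inXstar0 : mu (fun _ => 0) = 0.
Proof.
have c0 : inX (fun _ : T => 0 : R) by exact: inX_cst.
have := inXstar_add c0 c0.
rewrite [X in mu X](_ : _ = fun=> 0); last by apply/funext => t; rewrite addr0.
by move/eqP; rewrite -subr_eq0 opprD addNKr oppr_eq0 => /eqP.
Qed.

Lemma inXstar_scale (a : R) x : inX x -> mu (fun t => a * x t) = a * mu x.
Proof.
move=> cx; have := inXstar_lin a cx (@inX_cst R T 0); rewrite inXstar0 addr0 => <-.
by congr mu; apply/funext => t; rewrite addr0.
Qed.

Lemma inXstar_sub x y : inX x -> inX y -> mu (fun t => x t - y t) = mu x - mu y.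
Proof.
move=> cx cy; rewrite -mulN1r -inXstar_scale// -inXstar_add//; last exact: inX_scale.
by congr mu; apply/funext => t; rewrite mulN1r.
Qed.

Lemma inXstar_sum (n : nat) (f : nat -> T -> R) : (forall k, inX (f k)) ->
  mu (fun t => \sum_(k < n) f k t) = \sum_(k < n) mu (f k).
Proof.
move=> cf; elim: n => [|n IH].
  rewrite big_ord0 -[RHS]inXstar0; congr mu; apply/funext => t.
  by rewrite big_ord0.
rewrite big_ord_recr/= -IH -inXstar_add//; last exact: inX_sum.
by congr mu; apply/funext => t; rewrite big_ord_recr.
Qed.

(** [L x] is the supremum of [mu y] over [|y| <= x]; its additivity is the Riesz decomposition
    property. Estimates on signed functionals reduce to positive ones in this way. *)
Lemma total_variation :
  exists L, posf L /\ forall x, inX x -> `|mu x| <= L (fun t => `|x t|).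
Proof.
have [_ [M hM]] := hmu.
pose E x := [set mu y | y in [set y | inX y /\ forall t, `|y t| <= x t]].
pose L x := sup (E x).
have hE x : cpos x -> has_sup (E x).
  move=> [cx x0]; split.
    by exists (mu (fun _ => 0)), (fun _ => 0) => //; split=> [|t];
      [exact: inX_cst|rewrite normr0].
  exists (`|M| * supnorm x) => _ [y [cy yx] <-].
  apply: le_trans (ler_norm _) _; apply: le_trans (hM y cy) _.
  apply: le_trans (ler_wpM2r (supnorm_ge0 cy) (ler_norm M)) _.
  apply: ler_wpM2l => //; apply: supnorm_le; first exact: supnorm_ge0.
  by move=> t; apply: le_trans (yx t) _; exact: le_trans (ler_norm _) (le_supnorm t cx).
have leL x y : cpos x -> inX y -> (forall t, `|y t| <= x t) -> mu y <= L x.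
  by move=> hx cy yx; apply: sup_upper_bound; [exact: hE|exists y].
have Lle x c : cpos x ->
    (forall y, inX y -> (forall t, `|y t| <= x t) -> mu y <= c) -> L x <= c.
  move=> hx h; apply: ge_sup; first by case: (hE x hx).
  by move=> _ [y [cy yx] <-]; exact: h.
have LZ a x : 0 < a -> cpos x -> L (fun t => a * x t) <= a * L x.
  move=> a0 hx; apply: (Lle) => [|y cy yx].
    by apply: cpos_scale => //; exact: ltW.
  have -> : y = fun t => a * (a^-1 * y t).
    by apply/funext => t; rewrite mulVKf// gt_eqF.
  have cy' : inX (fun t => a^-1 * y t) by exact: inX_scale.
  rewrite inXstar_scale//; apply: ler_wpM2l; first exact: ltW.
  by apply: (leL) => // t; rewrite normrM gtr0_norm ?invr_gt0// ler_pdivrMl.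
exists L; split; last first.
  move=> x cx; have hx := cpos_abs cx; rewrite ler_norml; apply/andP; split.
    rewrite lerNl -mulN1r -inXstar_scale//; apply: (leL) => //; first exact: inX_scale.
    by move=> t; rewrite mulN1r normrN.
  exact: leL.
split.
- move=> x1 x2 h1 h2; have [c1 p1] := h1; have [c2 p2] := h2.
  have h12 := cpos_add h1 h2; apply/eqP; rewrite eq_le; apply/andP; split.
    apply: (Lle) => // y cy yx.
    (* [y1] truncates [y] to the interval from [- x1] to [x1]; the remainder then stays within
       [x2]. *)
    pose y1 t := Num.max (- x1 t) (Num.min (y t) (x1 t)).
    have cy1 : inX y1.
      by apply: inX_max; [exact: inX_opp|exact: inX_min].
    have cy2 : inX (fun t => y t - y1 t) by exact: inX_sub.
    have -> : mu y = mu y1 + mu (fun t => y t - y1 t) by rewrite inXstar_sub// subrKC.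
    have hy t : `|y1 t| <= x1 t /\ `|y t - y1 t| <= x2 t.
      have := p1 t; have := p2 t; have := yx t; rewrite /y1 !ler_norml => /andP[].
      by rewrite /Num.max /Num.min; case: (ltP (y t) (x1 t)) => ?; case: ltP => *; split;
        apply/andP; split; lra.
    by apply: lerD; apply: (leL) => // t; case: (hy t).
  rewrite -lerBrDr; apply: (Lle) => // y1 cy1 hy1.
  rewrite lerBrDr addrC -lerBrDr; apply: (Lle) => // y2 cy2 hy2.
  rewrite lerBrDr addrC -inXstar_add//; apply: (leL) => //; first exact: inX_add.
  by move=> t; apply: le_trans (ler_normD _ _) _; exact: lerD.
(* Scaling by 0 is separate: for [a > 0] the reverse inequality comes from [LZ] at [a^-1]. *)
- move=> a x; rewrite le_eqVlt => /orP[/eqP <- hx|a0 hx].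
    have -> : (fun t => 0 * x t) = fun t => 0 by apply/funext => t; rewrite mul0r.
    have p0 : cpos (fun _ : T => 0 : R) by exact: cpos_cst.
    rewrite mul0r; apply/eqP; rewrite eq_le; apply/andP; split.
      apply: (Lle) => // y _ y0; have -> : y = fun _ => 0; last by rewrite inXstar0.
      by apply/funext => t; apply/eqP; rewrite -normr_le0.
    by rewrite -[leLHS]inXstar0; apply: (leL) => // [|t]; [exact: inX_cst|rewrite normr0].
  apply/eqP; rewrite eq_le LZ//= -ler_pdivlMl//.
  apply: le_trans (LZ a^-1 _ _ _); rewrite ?invr_gt0//; last first.
    by apply: cpos_scale => //; exact: ltW.
  rewrite le_eqVlt; apply/orP; left; apply/eqP; congr L; apply/funext => t.
  by rewrite mulKf// gt_eqF.
- move=> x hx; rewrite -[leLHS]inXstar0; apply: (leL) => //; first exact: inX_cst.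
  by move=> t; rewrite normr0; case: hx.
Qed.

End Functional.
End DualSpace.

(** * Independent pairs of sets and their extraction along a filter *)

Definition indep (T : Type) (U V : nat -> set T) :=
  forall (n : nat) (s : nat -> bool),
    exists t, forall k, (k < n)%N -> if s k then U k t else V k t.

Section IndependentSequences.
Variables (T I : Type) (F : set_system I) (good : set T -> Prop).
Variables (U V : I -> set T) (Q : I -> I -> Prop).
Hypothesis FF : ProperFilter F.
Hypothesis goodT : good setT.
Hypothesis good_ne : forall W, good W -> W !=set0.
Hypothesis goodU : forall W, good W -> \forall i \near F, good (W `&` U i).
Hypothesis goodV : forall W, good W -> \forall i \near F, good (W `&` V i).
Hypothesis FQ : forall i, \forall j \near F, Q i j.

(** The list holds the latest index first, so [size l'] is the rank of its head and [s] is read in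
    the order of choice. *)
Fixpoint cell (l : seq I) (s : nat -> bool) : set T :=
  if l is i :: l' then cell l' s `&` (if s (size l') then U i else V i) else setT.

Lemma near_all_patterns (n : nat) (P : I -> seq bool -> Prop) :
  (forall s, \forall i \near F, P i s) ->
  \forall i \near F, forall s, size s = n -> P i s.
Proof.
elim: n P => [|n IH] P hP.
  by apply: filterS (hP [::]) => i Pi s /size0nil ->.
have hb b : \forall i \near F, forall s, size s = n -> P i (b :: s).
  by apply: (IH (fun i s => P i (b :: s))) => s; exact: hP.
apply: filterS (filterI (hb true) (hb false)) => i [h1 h0] [|[] s]//= [ss].
  exact: h1.
exact: h0.
Qed.

Lemma eq_cell l s1 s2 : (forall k, (k < size l)%N -> s1 k = s2 k) ->
  cell l s1 = cell l s2.
Proof.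
elim: l => [//|i l IH] /= h; rewrite h// IH// => k kl.
by apply: h; exact: ltnW.
Qed.

(** Indices are chosen one at a time so that every cell stays good. Each of the finitely many cells
    splits well for [F]-almost every index, hence one index serves them all. *)
Lemma independent_sequence : exists u : nat -> I,
  (forall k, Q (u k) (u k.+1)) /\ indep (U \o u) (V \o u).
Proof.
pose St := {l : seq I | forall s, good (cell l s)}.
pose step (a b : St) :=
  exists i, sval b = i :: sval a /\ (if sval a is j :: _ then Q j i else True).
have stepP (a : St) : {b : St | step a b}.
  apply: cid; case: a => l gl.
  have hg : \forall i \near F, forall s : seq bool, size s = (size l).+1 ->
      good (cell (i :: l) (nth false s)).
    apply: near_all_patterns => s /=.
    by case: (nth false s (size l)); [exact: goodU|exact: goodV].
  have hQ : \forall i \near F, if l is j :: _ then Q j i else True.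
    by case: (l) => [|j _]; [exact: filterT|exact: FQ].
  have [i [gi Qi]] := filter_ex (filterI hg hQ).
  (* A cell reads only [(size l).+1] values of the pattern, so [s] may be replaced by a finite
     word. *)
  have gil s : good (cell (i :: l) s).
    rewrite (@eq_cell _ s (nth false (mkseq s (size l).+1))) ?size_mkseq.
      by apply: gi; rewrite size_mkseq.
    by move=> k kl; rewrite nth_mkseq.
  by exists (exist _ (i :: l) gil), i.
have gnil (s : nat -> bool) : good (cell [::] s) by [].
have [f [f0 fS]] := dependent_choice stepP (exist _ [::] gnil).
have [u hu] := choice fS.
have fE n : sval (f n) = [seq u k | k <- rev (iota 0 n)].
  elim: n => [|n IH]; first by rewrite f0.
  by rewrite (hu n).1 IH -[n.+1]addn1 iotaD rev_cat/= add0n.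
exists u; split.
  by move=> k; have := (hu k.+1).2; rewrite (hu k).1.
move=> n s; have [t ht] := good_ne (svalP (f n) s); exists t.
rewrite fE in ht; elim: n ht => [//|n IH].
rewrite -{1}[n.+1]addn1 iotaD rev_cat/= add0n => -[/IH h].
rewrite size_map size_rev size_iota => hn k.
by rewrite ltnS leq_eqVlt => /orP[/eqP ->|/h//]; case: (s n) hn.
Qed.

End IndependentSequences.

(** * Independent functions are uniformly separated in the mean *)

Section Rademacher.
Variables (R : realType) (T : topologicalType).
Hypothesis hT : compact [set: T].

Definition flip (n : nat) (i : 'I_n) (s : {ffun 'I_n -> bool}) :
  {ffun 'I_n -> bool} := [ffun k => s k (+) (k == i)].

Lemma flipK n (i : 'I_n) : involutive (flip i).
Proof.
by move=> s; apply/ffunP => k; rewrite !ffunE -addbA addbb addbF.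
Qed.

(* The functional is an ultralimit of averages over one point in each of the
   2^n cells: under it the two sides of every [f i] become fair coin tosses. *)
Lemma indep_separated (f : nat -> T -> R) (a b : R) : a < b ->
  (forall k, inX (f k)) ->
  indep (fun k => [set t | b < f k t]) (fun k => [set t | f k t < a]) ->
  exists2 L, posf L & forall i j, (i < j)%N ->
    (b - a) / 2 <= L (fun t => `|f i t - f j t|).
Proof.
move=> ab cf hf.
have exP n : exists p : {ffun 'I_n -> bool} -> T,
    forall (s : {ffun 'I_n -> bool}) (k : 'I_n),
      if s k then b < f k (p s) else f k (p s) < a.
  have hp (s : {ffun 'I_n -> bool}) : exists t,
      forall k : 'I_n, if s k then b < f k t else f k t < a.
    have [t ht] := hf n (fun k => if insub k is Some k' then s k' else false).
    by exists t => k; have := ht k (ltn_ord k); rewrite valK; case: (s k).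
  by have [p] := choice hp; exists p.
pose p n := sval (cid (exP n)).
have hp n : forall (s : {ffun 'I_n -> bool}) (k : 'I_n),
    if s k then b < f k (p n s) else f k (p n s) < a.
  exact: svalP (cid (exP n)).
pose N n : R := #|{ffun 'I_n -> bool}|%:R.
have N0 n : 0 < N n.
  by rewrite ltr0n card_ffun card_bool expn_gt0.
pose A n (x : T -> R) := (\sum_s x (p n s)) / N n.
have [G [GU ooG]] := ultraFilterLemma eventually_filter.
pose L x := lim (A ^~ x @ G).
have AB n x M : (forall t, `|x t| <= M) -> `|A n x| <= M.
  move=> xM; rewrite normrM normfV (gtr0_norm (N0 n)) ler_pdivrMr//.
  apply: le_trans (ler_norm_sum _ _ _) _.
  apply: le_trans (ler_sum _ (fun s _ => xM (p n s))) _.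
  by rewrite sumr_const -mulr_natr.
have cvL x : inX x -> A ^~ x @ G --> L x.
  move=> /(inX_bounded hT)[M _ xM]; apply: (@ultra_bounded_cvg _ _ _ _ M) => n.
  exact: AB.
have hL : posf L.
  split.
  - move=> x y [cx _] [cy _]; apply/cvg_lim => //.
    rewrite [X in X @ _](_ : _ = (fun n => A n x + A n y)).
      exact: cvgD (cvL x cx) (cvL y cy).
    by apply/funext => n; rewrite /A big_split/= mulrDl.
  - move=> c x c0 [cx _]; apply/cvg_lim => //.
    rewrite [X in X @ _](_ : _ = (fun n => c * A n x)).
      exact: cvgM (cvg_cst c) (cvL x cx).
    by apply/funext => n; rewrite /A -mulr_sumr mulrA.
  - move=> x [cx x0]; apply: cvgr_to_ge (cvL x cx) _.
    apply: filterS filterT => n _; apply: divr_ge0; last exact: ltW.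
    exact: sumr_ge0.
exists L => // i j ij.
have cd : inX (fun t => `|f i t - f j t|) by apply: inX_abs; exact: inX_sub.
apply: cvgr_to_ge (cvL _ cd) _; apply: ooG; exists j.+1 => // n /= jn.
pose i' := Ordinal (ltn_trans ij jn).
pose g s := `|f i (p n s) - f j (p n s)|.
(* Flipping coin [i] moves [f i] across the gap and leaves [f j] on its side; in one of the two
   cells they lie on opposite sides. *)
have gap s : b - a <= g s + g (flip i' s).
  have gj := hp n s (Ordinal jn); have gi := hp n s i'.
  have hj := hp n (flip i' s) (Ordinal jn); have hi := hp n (flip i' s) i'.
  rewrite /flip !ffunE -[Ordinal jn == i']val_eqE/= (gtn_eqF ij) eqxx in hi hj.
  have : (b - a <= g s) || (b - a <= g (flip i' s)).
    rewrite /g !ler_normr -/(flip i' s) in hi hj *.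
    move: gi gj hi hj; rewrite addbT addbF/=.
    by case: (s i'); case: (s (Ordinal jn)) => /= *; apply/orP;
      (try by left; apply/orP; (try by left; lra); right; lra);
      right; apply/orP; (try by left; lra); right; lra.
  have g0 s' : 0 <= g s' by exact: normr_ge0.
  by case/orP => [h|h]; [rewrite ler_wpDr|rewrite ler_wpDl].
have -> : A n (fun t => `|f i t - f j t|) = (\sum_s g s) / N n by [].
(* The flip permutes the cells, so summing [gap] bounds twice the sum of [g]: hence the factor
   1/2. *)
have flipE : \sum_s g s = \sum_s g (flip i' s).
  exact: (reindex_inj (inv_inj (flipK i'))).
rewrite ler_pdivlMr// mulrAC ler_pdivrMr// [leRHS]mulr_natr mulr2n {2}flipE -big_split/=.
rewrite [leLHS](_ : _ = \sum_(s : {ffun 'I_n -> bool}) (b - a)).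
  by apply: ler_sum => s _; exact: gap.
by rewrite sumr_const mulr_natr.
Qed.

End Rademacher.

(** * Infinite subsets of the naturals and diagonalization *)

Section InfiniteSubsets.
Implicit Types A B : set nat.

Definition unbounded A := forall n, exists2 m, (n <= m)%N & A m.

Definition almost_sub A B := exists n, forall m, (n <= m)%N -> A m -> B m.

Lemma within_unbounded_proper B : unbounded B -> ProperFilter (within B \oo).
Proof.
move=> hB; split; last exact: within_filter.
by move=> [n _ hn]; have [m nm Bm] := hB n; exact: hn m nm Bm.
Qed.

Lemma within_tail B n : within B \oo [set k | (n <= k)%N /\ B k].
Proof. by exists n. Qed.

(** A decreasing chain [C] of infinite sets meets the requirements one by one; picking [u n >= n] in
    [C n.+1] gives a set almost contained in each of them. *)
Lemma unbounded_diagonal (P : nat -> set nat -> Prop) :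
  (forall j A B, almost_sub A B -> P j B -> P j A) ->
  (forall j A, unbounded A -> exists B, [/\ unbounded B, B `<=` A & P j B]) ->
  forall A, unbounded A ->
    exists B, [/\ unbounded B, B `<=` A & forall j, P j B].
Proof.
move=> hP step A uA.
pose St := {jA : nat * set nat | unbounded jA.2}.
pose Q (a b : St) := [/\ (sval b).1 = (sval a).1.+1,
  (sval b).2 `<=` (sval a).2 & P (sval a).1 (sval b).2].
have QP (a : St) : {b : St | Q a b}.
  apply: cid; case: a => -[j C] /= uC; have [B [uB BC PB]] := step j C uC.
  by exists (exist _ (j.+1, B) uB).
have [h [h0 hS]] := dependent_choice QP (exist _ (0%N, A) uA).
have h1 n : (sval (h n)).1 = n.
  by elim: n => [|n IH]; [rewrite h0|have [-> _ _] := hS n; rewrite IH].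
pose C n := (sval (h n)).2.
have CS n : C n.+1 `<=` C n by have [_] := hS n.
have Cmono m n : (m <= n)%N -> C n `<=` C m.
  move=> /subnK <-; elim: (n - m)%N => [//|k IH].
  by rewrite addSn; exact: subset_trans (CS _) IH.
have PC n : P n (C n.+1) by have [_ _] := hS n; rewrite h1.
have exu n : exists m, (n <= m)%N /\ C n.+1 m.
  by have [m] := svalP (h n.+1) n; exists m.
have [u hu] := choice exu.
exists (range u); split.
- by move=> n; exists (u n); [case: (hu n)|exists n].
- move=> _ [n _ <-]; have [_] := hu n; have := @Cmono 0%N n.+1 isT.
  by rewrite /C h0; apply.
(* [u] need not be increasing: an element larger than all [u i] with [i < j] has index at least [j],
   hence lies in [C j.+1]. *)
- move=> j; apply: hP (PC j); exists (\max_(i < j) u i).+1 => m hm [n _ E].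
  rewrite -E in hm *; have [jn|nj] := leqP j n.
    by apply: (Cmono j.+1 n.+1) => //; case: (hu n).
  by have := @leq_bigmax _ (fun i : 'I_j => u i) (Ordinal nj); rewrite leqNgt hm.
Qed.

End InfiniteSubsets.

(** * Rosenthal's dichotomy over a countable base *)

Section Rosenthal.
Variables (R : realType) (T : topologicalType) (W : nat -> set T).
Hypothesis oW : forall j, open (W j).
Hypothesis Wbase : forall (O : set T) t, open O -> O t ->
  exists j, W j t /\ W j `<=` O.
Variables (f : nat -> T -> R) (M : R).
Hypothesis cf : forall k, inX (f k).
Hypothesis fM : forall k t, `|f k t| <= M.
Hypothesis nindep : forall a b (u : nat -> nat), a < b ->
  (forall k, (u k < u k.+1)%N) ->
  ~ indep (fun k => [set t | b < f (u k) t]) (fun k => [set t | f (u k) t < a]).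

Definition oscillates (a b : R) (B : set nat) (s : T) :=
  (forall n, exists k, [/\ (n <= k)%N, B k & b < f k s]) /\
  (forall n, exists k, [/\ (n <= k)%N, B k & f k s < a]).

Lemma almost_sub_oscillates a b A B s : almost_sub A B ->
  oscillates a b A s -> oscillates a b B s.
Proof.
move=> [m hm] [h1 h2]; split=> n.
  have [k [nk Ak fk]] := h1 (maxn m n); exists k; split=> //.
    by apply: leq_trans nk; exact: leq_maxr.
  by apply: hm => //; apply: leq_trans nk; exact: leq_maxl.
have [k [nk Ak fk]] := h2 (maxn m n); exists k; split=> //.
  by apply: leq_trans nk; exact: leq_maxr.
by apply: hm => //; apply: leq_trans nk; exact: leq_maxl.
Qed.

(* Diagonalizing over the base, [B] is stable: a basic open set containing an
   oscillation point of [B] contains one of every infinite subset of [B]. *)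
Lemma nonoscillating_subset a b A : a < b -> unbounded A ->
  exists B, [/\ unbounded B, B `<=` A & forall s, ~ oscillates a b B s].
Proof.
move=> ab uA.
(* On [W j], either no point oscillates along [B], or every infinite subset of [B] keeps an
   oscillating point there. Both alternatives pass to almost subsets. *)
pose P j B := (forall s, W j s -> ~ oscillates a b B s) \/
  (forall B', unbounded B' -> B' `<=` B -> exists s, W j s /\ oscillates a b B' s).
have [j C D CD PD|j C uC|B [uB BA PB]] := @unbounded_diagonal P _ _ A uA.
- case: PD => [no|all]; [left|right].
    by move=> s js oC; apply: (no s js); exact: almost_sub_oscillates oC.
  move=> C' uC' C'C; have [n hn] := CD.
  have [k|m [/= nm C'm]|s [js os]] := all [set m | (n <= m)%N /\ C' m].
  + have [m km C'm] := uC' (maxn n k); exists m.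
      by apply: leq_trans km; exact: leq_maxr.
    by split=> //; apply: leq_trans km; exact: leq_maxl.
  + by apply: hn => //; exact: C'C.
  by exists s; split=> //; apply: almost_sub_oscillates os; exists 0%N => m _ [].
- have [[B [uB BC no]]|all] := pselect (exists B,
      [/\ unbounded B, B `<=` C & forall s, W j s -> ~ oscillates a b B s]).
    by exists B; split=> //; left.
  exists C; split=> //; right=> B uB BC; apply: contrapT => no.
  by apply: all; exists B; split=> // s js os; apply: no; exists s.
exists B; split=> // s0 os0.
pose good V := exists j s, [/\ W j `<=` V, W j s & oscillates a b B s].
(* If infinitely many [k] in [B] failed, stability would give a point oscillating along those [k],
   and it would lie in one of their [O k]. *)
have goodI V (O : nat -> set T) : (forall k, open (O k)) -> (forall B' s,
    oscillates a b B' s -> exists2 k, B' k & O k s) -> good V ->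
    \forall k \near within B \oo, good (V `&` O k).
  move=> oO hO [j [s [jV js os]]]; apply: contrapT => hn.
  have [no|all] := PB j; first exact: no s js os.
  have [k|k []//|s' [js' os']] := all [set k | B k /\ ~ good (V `&` O k)].
    apply: contrapT => hk; apply: hn; exists k => // m /= km Bm.
    by apply: contrapT => ng; apply: hk; exists m.
  have [k [Bk ng] Oks'] := hO _ _ os'; apply: ng.
  have [j' [js'' j'O]] := Wbase (openI (oW j) (oO k)) (conj js' Oks').
  exists j', s'; split=> //.
    by move=> t /j'O[/jV].
  by apply: almost_sub_oscillates os'; exists 0%N => m _ [].
have FB := within_unbounded_proper uB.
have [||||i|u [uS]] := @independent_sequence T nat (within B \oo) good
  (fun k => [set t | b < f k t]) (fun k => [set t | f k t < a])
  (fun i k => (i < k)%N) FB.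
- have [j [js0 _]] := Wbase openT (I : setT s0).
  by exists j, s0.
- by move=> V [j [s [jV js _]]]; exists s; exact: jV.
- move=> V; apply: goodI => [k|B' s [h _]]; first exact: open_gt.
  by have [k [_ Bk bk]] := h 0%N; exists k.
- move=> V; apply: goodI => [k|B' s [_ h]]; first exact: open_lt.
  by have [k [_ Bk bk]] := h 0%N; exists k.
- by exists i.+1.
by apply: nindep.
Qed.

(** One diagonalization handles all pairs of rationals, and any [a < b] has two rationals strictly
    between. *)
Lemma nonoscillating_subset_all A : unbounded A -> exists B,
  [/\ unbounded B, B `<=` A & forall a b s, a < b -> ~ oscillates a b B s].
Proof.
pose P j B := if unpickle j is Some (p, q) then ratr p < ratr q :> R ->
  forall s, ~ oscillates (ratr p) (ratr q) B s else True.
move=> uA.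
have [j C D CD|j C uC|B [uB BA PB]] := @unbounded_diagonal P _ _ A uA.
- rewrite /P; case: unpickle => [[p q] PD pq s oC|]; last by [].
  exact: PD pq s (almost_sub_oscillates CD oC).
- rewrite /P; case: unpickle => [[p q]|]; last by exists C; split.
  have [pq|pq] := boolP (ratr p < ratr q :> R); last first.
    by exists C; split=> // pq'; rewrite pq' in pq.
  by have [B [uB BC hB]] := nonoscillating_subset pq uC; exists B.
exists B; split=> // a b s ab [h1 h2].
have [p] := rat_in_itvoo ab; rewrite in_itv/= => /andP[ap pb].
have [q] := rat_in_itvoo pb; rewrite in_itv/= => /andP[pq qb].
have := PB (pickle (p, q)); rewrite /P pickleK => /(_ _ s); apply=> //.
split=> n.
  have [k [nk Bk bk]] := h1 n; exists k; split=> //.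
  exact: lt_trans bk.
have [k [nk Bk bk]] := h2 n; exists k; split=> //.
exact: lt_trans bk ap.
Qed.

(** Two ultrafilters with different limits at [s] would make [s] oscillate between levels separating
    them, so all ultralimits agree. *)
Lemma pointwise_convergent_subset A : unbounded A -> exists B,
  [/\ unbounded B, B `<=` A & forall s, cvg (f ^~ s @ within B \oo)].
Proof.
move=> /nonoscillating_subset_all[B [uB BA nosc]]; exists B; split=> // s.
have FB := within_unbounded_proper uB.
have cvG G : UltraFilter G -> f ^~ s @ G --> lim (f ^~ s @ G).
  by move=> GU; apply: (@ultra_bounded_cvg _ _ _ _ M).
have nlt G G' : UltraFilter G -> UltraFilter G' -> within B \oo `<=` G ->
    within B \oo `<=` G' -> ~ (lim (f ^~ s @ G) < lim (f ^~ s @ G')).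
  move=> GU GU' BG BG'; set l := lim _; set l' := lim _ => ll'.
  apply: (nosc (l + (l' - l) / 3) (l + 2 * (l' - l) / 3) s); first lra.
  have hG : G [set k | f k s < l + (l' - l) / 3].
    by apply: (cvgr_lt l); [exact: cvG|lra].
  have hG' : G' [set k | l + 2 * (l' - l) / 3 < f k s].
    by apply: (cvgr_gt l'); [exact: cvG|lra].
  split=> n.
    have [k [/= ? [? ?]]] := filter_ex (filterI hG' (BG' _ (@within_tail B n))).
    by exists k.
  have [k [/= ? [? ?]]] := filter_ex (filterI hG (BG _ (@within_tail B n))).
  by exists k.
have [G [GU BG]] := ultraFilterLemma FB.
apply/cvg_ex; exists (lim (f ^~ s @ G)); apply: ultra_cvg => G' GU' BG'.
have := cvG G' GU'; suff -> : lim (f ^~ s @ G') = lim (f ^~ s @ G) by [].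
have /negP := nlt G G' GU GU' BG BG'; rewrite -leNgt => h1.
have /negP := nlt G' G GU' GU BG' BG; rewrite -leNgt => h2.
by apply/eqP; rewrite eq_le h1 h2.
Qed.

End Rosenthal.

(** The cube of side [2 K] is cut into boxes of side [e]; with one index more than there are boxes,
    two vectors share a box. *)
Lemma pigeonhole_bounded (R : realType) (n : nat) (d : nat -> 'I_n -> R) (K e : R) :
  0 < e -> (forall k l, `|d k l| <= K) ->
  exists i j, (i < j)%N /\ forall l, `|d i l - d j l| <= e.
Proof.
move=> e0 dK; pose B := Num.truncn ((K + K) / e).
pose g k l := (d k l + K) / e.
have g0 k l : 0 <= g k l.
  by apply: divr_ge0; [have := dK k l; rewrite ler_norml => /andP[]; lra|exact: ltW].
have gB k l : (Num.truncn (g k l) < B.+1)%N.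
  rewrite ltnS; apply: le_truncn; rewrite ler_pM2r ?invr_gt0// lerD2r.
  by apply: le_trans (dK k l); exact: ler_norm.
pose h (k : nat) : {ffun 'I_n -> 'I_B.+1} := [ffun l => Ordinal (gB k l)].
pose C := #|{ffun 'I_n -> 'I_B.+1}|.
have ninj : ~ injective (fun k : 'I_C.+1 => h k).
  by move=> /leq_card; rewrite card_ord ltnn.
have [i [j [ij E]]] : exists i j : nat, (i < j)%N /\ h i = h j.
  apply: contrapT => no; apply: ninj => i j E; apply/val_inj/eqP.
  by case: ltngtP => // [ij|ji]; case: no; [exists i, j|exists j, i].
exists i, j; split=> // l.
have /(congr1 val)/= tE : h i l = h j l by rewrite E.
rewrite !ffunE/= in tE.
have := truncn_itv (g0 i l); have := truncn_itv (g0 j l); rewrite tE.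
move: (Num.truncn _) => m /andP[j1 j2] /andP[i1 i2].
have : `|g i l - g j l| < 1 by rewrite ltr_norml -addn1 natrD in i2 j2 *; lra.
have -> : g i l - g j l = (d i l - d j l) / e by rewrite /g -mulrBl; congr (_ / _); ring.
by rewrite normrM (gtr0_norm (_ : 0 < e^-1)) ?invr_gt0// ltr_pdivrMr// mul1r => /ltW.
Qed.

(** * Compact metric spaces: finite nets, a countable base, a countable family with dense span *)

Section MetricBase.
Variables (R : realType) (T : metricType R).
Hypothesis hT : compact [set: T].

Lemma inX_mdist (s : T) : inX (fun t => mdist s t).
Proof.
move=> t; apply/cvgrPdist_lt => e e0.
have := nbhsx_ballx t _ e0; rewrite ballEmdist; apply: filterS => u /= tu.
have := metric_triangle s t u; have := metric_triangle s u t.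
by rewrite (metric_sym u t) ltr_norml => *; apply/andP; split; lra.
Qed.

Lemma open_mdist_lt (s : T) (r : R) : open [set t | mdist s t < r].
Proof. by apply: open_lt; exact: inX_mdist. Qed.

Lemma finite_nets (t0 : T) : exists (tau : nat -> nat -> T) (m : nat -> nat),
  forall n s, exists2 i, (i < m n)%N & mdist (tau n i) s < n.+1%:R^-1.
Proof.
have [l hl] : exists l : nat -> seq T, forall n s,
    exists2 t, t \in l n & mdist t s < n.+1%:R^-1.
  have hn n : exists l : seq T, forall s, exists2 t, t \in l & mdist t s < n.+1%:R^-1.
    apply: (compact_seq_cover hT (O := fun t => [set s | mdist t s < n.+1%:R^-1])) => t.
      exact: open_mdist_lt.
    by rewrite /= mdistxx invr_gt0.
  by have [l] := choice hn; exists l.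
exists (fun n => nth t0 (l n)), (fun n => size (l n)) => n s.
have [t tl ts] := hl n s; exists (index t (l n)); first by rewrite index_mem.
by rewrite nth_index.
Qed.

Lemma exists_countable_base : exists W : nat -> set T,
  (forall j, open (W j)) /\
  forall (O : set T) t, open O -> O t -> exists j, W j t /\ W j `<=` O.
Proof.
have [[t0 _]|T0] := pselect (exists t : T, True); last first.
  exists (fun _ => set0); split=> [_|O t]; first exact: open0.
  by case: T0; exists t.
have [tau [m htau]] := finite_nets t0.
exists (fun j => if unpickle j is Some (n, i) then
  [set s | mdist (tau n i) s < n.+1%:R^-1] else set0); split=> [j|O t oO Ot].
  by case: unpickle => [[n i]|]; [exact: open_mdist_lt|exact: open0].
have := open_nbhs_nbhs (conj oO Ot); rewrite -nbhs_ballE => -[r /= r0].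
rewrite ballEmdist => hr.
have [n hn] : exists n, n.+1%:R^-1 < r / 2.
  have r2 : 0 < r / 2 by rewrite divr_gt0.
  by have [n] := ltr_add_invr r2; rewrite add0r; exists n.
have [i _ it] := htau n t; exists (pickle (n, i)); rewrite pickleK; split=> // s /= is_.
apply: hr => /=; apply: le_lt_trans (metric_triangle t (tau n i) s) _.
by rewrite (metric_sym t); move: it is_ hn; move: (_^-1) => q; lra.
Qed.

(** Lebesgue number argument: balls of half the radius of continuity cover, and the least of
    finitely many such radii is uniform. *)
Lemma uniformly_continuous (x : T -> R) (e : R) : inX x -> 0 < e ->
  exists2 r, 0 < r & forall s t, mdist s t < r -> `|x s - x t| < e.
Proof.
move=> cx e0.
have hr (t : T) : exists r, 0 < r /\ forall s, mdist t s < r + r -> `|x t - x s| < e / 2.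
  have /cvgrPdist_lt/(_ (e / 2)) := cx t.
  have e2 : 0 < e / 2 by lra.
  move=> /(_ e2); rewrite -nbhs_ballE => -[r /= r0]; rewrite ballEmdist => h.
  by exists (r / 2); split=> [|s]; [lra|rewrite -splitr; exact: h].
have [r hr'] := choice hr.
have [t|t|l hl] := compact_seq_cover hT (O := fun t => [set s | mdist t s < r t]).
- exact: open_mdist_lt.
- by rewrite /= mdistxx; case: (hr' t).
have [r1 r10 hr1] : exists2 r1 : R, 0 < r1 & forall u, u \in l -> r1 <= r u.
  elim: (l) => [|u l' [r1 r10 hr1]]; first by exists 1.
  exists (Num.min (r u) r1); first by rewrite lt_min r10 andbT; case: (hr' u).
  move=> v; rewrite inE ge_min => /orP[/eqP ->|/hr1 ->]; first by rewrite lexx.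
  by rewrite orbT.
exists r1 => // s t st; have [u ul us] := hl s.
have ru : mdist s t < r u by apply: lt_le_trans st _; exact: hr1.
have [r0 h] := hr' u.
have h1 := h s (ltr_wpDr (ltW r0) us).
have h2 : `|x u - x t| < e / 2.
  by apply: h; apply: le_lt_trans (metric_triangle u s t) _; exact: ltrD.
have -> : x s - x t = (x u - x t) - (x u - x s) by ring.
apply: le_lt_trans (ler_normB _ _) _; lra.
Qed.

(* The [e n i] form the partition of unity made of normalized bumps of radius
   1/(n+1) around a finite net. *)
Lemma countable_dense_span : exists e : nat -> nat -> T -> R,
  (forall n i, inX (e n i)) /\
  forall x d, inX x -> 0 < d -> exists n m (c : nat -> R),
    forall s, `|x s - \sum_(i < m) c i * e n i s| <= d.
Proof.
have [[t0 _]|T0] := pselect (exists t : T, True); last first.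
  exists (fun _ _ _ => 0); split=> [n i|x d _ _]; first exact: inX_cst.
  by exists 0%N, 0%N, (fun _ => 0) => s; case: T0; exists s.
have [tau [m htau]] := finite_nets t0.
pose b n i s := Num.max 0 (n.+1%:R^-1 - mdist (tau n i) s).
pose D n s := \sum_(i < m n) b n i s.
have b0 n i s : 0 <= b n i s by rewrite le_max lexx.
have cb n i : inX (b n i).
  by apply: inX_max; [exact: inX_cst|apply: inX_sub; [exact: inX_cst|exact: inX_mdist]].
have D0 n s : 0 < D n s.
  have [i im ts] := htau n s; rewrite /D (bigD1 (Ordinal im))//=.
  apply: ltr_wpDr; first exact: sumr_ge0.
  by rewrite lt_max subr_gt0 ts orbT.
pose e n i s := b n i s / D n s.
have e0 n i s : 0 <= e n i s by apply: divr_ge0 => //; exact: ltW.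
have e1 n s : \sum_(i < m n) e n i s = 1.
  by rewrite /e -mulr_suml divff// gt_eqF//; exact: D0.
exists e; split.
  move=> n i s; apply: cvgM (cb n i s) _; apply: cvgV; first by rewrite gt_eqF.
  have cD : inX (D n) by apply: inX_sum.
  exact: cD.
move=> x d cx d0; have [r r0 hr] := uniformly_continuous cx d0.
have [n hn] : exists n, n.+1%:R^-1 < r.
  by have [n] := ltr_add_invr r0; rewrite add0r; exists n.
exists n, (m n), (fun i => x (tau n i)) => s.
have -> : x s - \sum_(i < m n) x (tau n i) * e n i s =
    \sum_(i < m n) (x s - x (tau n i)) * e n i s.
  rewrite -{1}[x s]mulr1 -(e1 n s) mulr_sumr -sumrB.
  by apply: eq_bigr => i _; rewrite mulrBl.
rewrite -[d]mulr1 -(e1 n s) mulr_sumr.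
apply: le_trans (ler_norm_sum _ _ _) _; apply: ler_sum => i _.
rewrite normrM (ger0_norm (e0 _ _ _)).
have [ts|ts] := ltP (mdist (tau n i) s) n.+1%:R^-1.
  by apply: ler_wpM2r => //; rewrite distrC; apply/ltW/hr; exact: lt_trans hn.
suff -> : e n i s = 0 by rewrite !mulr0.
by rewrite /e /b max_l ?mul0r// subr_le0.
Qed.

End MetricBase.

(** * Tameness makes orbits and their hulls totally bounded in the mean *)

Section OrbitHull.
Variables (R : realType) (T : metricType R) (phi : T -> T).
Hypothesis hT : compact [set: T].
Hypothesis cphi : continuous phi.
Implicit Types (x y : T -> R).

Lemma inX_iter x n : inX x -> inX (fun t => x (iter n phi t)).
Proof.
move=> cx; elim: n => [//|n IH]; have := inX_comp cphi IH.
by congr inX; apply/funext => t; rewrite iterSr.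
Qed.

(** Given coefficients [c], take a point following their signs and one following the opposite signs:
    the combination differs there by at least [b - a], so its norm cannot fall below
    [(b - a) / 2]. *)
Lemma tame_not_indep x (a b : R) (u : nat -> nat) : tame R phi -> inX x ->
  a < b -> (forall k, (u k < u k.+1)%N) ->
  ~ indep (fun k => [set t | b < x (iter (u k) phi t)])
          (fun k => [set t | x (iter (u k) phi t) < a]).
Proof.
move=> htame cx ab hu hind.
have := htame x cx u hu; set E := [set r | _] => E0.
have hE : has_inf E.
  split.
    exists (supnorm (fun t => \sum_(k < 1) 1 * x (iter (u k) phi t))).
    by exists 1%N, (fun _ => 1); rewrite big_ord1 normr1.
  exists 0 => _ [N [c [_ ->]]]; apply: (supnorm_ge0 hT).
  by apply: (@inX_sum _ _ N (fun k t => c k * x (iter (u k) phi t))) => k;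
    apply: inX_scale; exact: inX_iter.
have d0 : 0 < (b - a) / 4 by lra.
have [_ [N [c [c1 ->]]]] := inf_adherent d0 hE; rewrite E0 add0r.
set y := fun t => _ => yd.
have cy : inX y.
  by apply: (@inX_sum _ _ N (fun k t => c k * x (iter (u k) phi t))) => k;
    apply: inX_scale; exact: inX_iter.
have [t1 h1] := hind N (fun k => 0 <= c k).
have [t2 h2] := hind N (fun k => ~~ (0 <= c k)).
have : b - a <= y t1 - y t2.
  rewrite -[b - a]mul1r -c1 /y -sumrB mulr_suml; apply: ler_sum => k _.
  rewrite -mulrBr; move: (h1 k (ltn_ord k)) (h2 k (ltn_ord k)).
  have [ck|ck] /= := leP 0 (c k) => g1 g2.
    by rewrite ger0_norm//; apply: ler_wpM2l => //; lra.
  by rewrite ltr0_norm// mulNr -mulrN; apply: ler_wnM2l; [exact: ltW|lra].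
have := le_supnorm hT t1 cy; have := le_supnorm hT t2 cy.
by rewrite !ler_norml => /andP[? ?] /andP[? ?]; lra.
Qed.

(** Otherwise some subsequence of the orbit is [e]-separated. It has a pointwise convergent
    subsequence, whose consecutive differences tend to 0 under [L] by bounded convergence. *)
Lemma orbit_totally_bounded x L (e : R) : tame R phi -> inX x -> posf L ->
  0 < e -> exists N, forall n, exists2 m, (m <= N)%N &
    L (fun t => `|x (iter n phi t) - x (iter m phi t)|) < e.
Proof.
move=> htame cx hL e0; apply: contrapT => hN.
have cxi n : inX (fun t => x (iter n phi t)) by exact: inX_iter.
have [v hv] : exists v : nat -> nat, forall N m, (m <= N)%N ->
    e <= L (fun t => `|x (iter (v N) phi t) - x (iter m phi t)|).
  have ex N : exists n, forall m, (m <= N)%N ->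
      e <= L (fun t => `|x (iter n phi t) - x (iter m phi t)|).
    apply: contrapT => hn; apply: hN; exists N => n.
    apply: contrapT => hm; apply: hn; exists n => m mN.
    by rewrite leNgt; apply/negP => lt; apply: hm; exists m.
  by have [v] := choice ex; exists v.
(* [v N] has distance 0 to itself, so it cannot be among the first indices; iterating [v] is
   therefore strictly increasing. *)
have vN N : (N < v N)%N.
  rewrite ltnNge; apply/negP => /hv; rewrite leNgt => /negP; apply.
  have -> : (fun t => `|x (iter (v N) phi t) - x (iter (v N) phi t)|) =
            (fun _ => 0).
    by apply/funext => t; rewrite subrr normr0.
  by rewrite (posf0 hL).
pose u k := iter k v 0%N.
have uS k : (u k < u k.+1)%N by exact: vN.
have umono : {homo u : i j / (i < j)%N} by apply: homo_ltn => //; exact: ltn_trans.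
have usep i j : (i < j)%N ->
    e <= L (fun t => `|x (iter (u j) phi t) - x (iter (u i) phi t)|).
  case: j => // j; rewrite ltnS leq_eqVlt => /orP[/eqP ->|/umono /ltnW]; exact: hv.
have uu : unbounded (range u).
  move=> n; exists (u n); last by exists n.
  by elim: n => // n IH; exact: leq_ltn_trans IH (uS n).
have [M M0 xM] := inX_bounded hT cx.
have [W [oW hW]] := exists_countable_base hT.
have [B [uB BA hB]] := pointwise_convergent_subset oW hW cxi
  (fun k t => xM (iter k phi t))
  (fun a b u ab hu => @tame_not_indep x a b u htame cx ab hu) uu.
have nextP (a : {n | B n}) : {b : {n | B n} | (sval a < sval b)%N}.
  by apply: cid; have [m am Bm] := uB (sval a).+1; exists (exist _ m Bm).
have [m0 _ Bm0] := uB 0%N.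
have [p [_ pS]] := dependent_choice nextP (exist _ m0 Bm0).
have pk k : (k <= sval (p k))%N.
  by elim: k => // k IH; exact: leq_ltn_trans IH (pS k).
pose g k t := `|x (iter (sval (p k)) phi t) - x (iter (sval (p k.+1)) phi t)|.
have cg k : cpos (g k) by apply: cpos_abs; exact: inX_sub.
have [|t d d0|k hk] := bounded_convergence hT (M := M + M) hL cg _ _ e0.
- by move=> k t; apply: le_trans (ler_normB _ _) _; exact: lerD.
- have /cvg_ex[l /cvgrPdist_lt hl] := hB t.
  have d2 : 0 < d / 2 by rewrite divr_gt0.
  have [n _ hn] := hl _ d2; exists n => k nk.
  have h1 := hn _ (leq_trans nk (pk k)) (svalP (p k)).
  have h2 := hn _ (leq_trans (leq_trans nk (leqnSn k)) (pk k.+1)) (svalP (p k.+1)).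
  rewrite /g [ltRHS]splitr; apply: le_lt_trans (ler_distD l _ _) _.
  by apply: ltrD => //; rewrite distrC.
have [i _ iE] := BA _ (svalP (p k)); have [j _ jE] := BA _ (svalP (p k.+1)).
have ij : (i < j)%N.
  rewrite ltnNge; apply/negP; rewrite leq_eqVlt => /orP[/eqP ji|/umono ji].
    by have := pS k; rewrite -iE -jE ji ltnn.
  by have := pS k; rewrite -iE -jE ltnNge ltnW.
have := hk k (leqnn k); rewrite /g -iE -jE ltNge => /negP; apply.
rewrite (_ : (fun t => _) = fun t => `|x (iter (u j) phi t) - x (iter (u i) phi t)|).
  exact: usep.
by apply/funext => t; rewrite distrC.
Qed.

(* The bound 2 makes the set stable under differences of convex combinations. *)
Definition orbit_hull x : set (T -> R) := [set y | exists N (c : nat -> R),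
  \sum_(n < N) `|c n| <= 2 /\ y = fun t => \sum_(n < N) c n * x (iter n phi t)].

Lemma inX_orbit_hull x y : inX x -> orbit_hull x y -> inX y.
Proof.
move=> cx [N [c [_ ->]]].
by apply: (@inX_sum _ _ N (fun n t => c n * x (iter n phi t))) => n;
  apply: inX_scale; exact: inX_iter.
Qed.

Lemma orbit_hull_bound x y (M : R) : (forall t, `|x t| <= M) -> orbit_hull x y ->
  forall t, `|y t| <= 2 * M.
Proof.
move=> xM [N [c [c2 ->]]] t; apply: le_trans (ler_norm_sum _ _ _) _.
apply: (@le_trans _ _ ((\sum_(n < N) `|c n|) * M)).
  by rewrite mulr_suml; apply: ler_sum => n _; rewrite normrM ler_wpM2l.
by apply: ler_wpM2r => //; apply: le_trans (xM t).
Qed.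

(** Replacing each iterate by a near one of index at most [N0] costs little and leaves coefficient
    vectors in a cube of fixed dimension, where two of them nearly coincide. *)
Lemma orbit_hull_not_separated x L (e : R) (y : nat -> T -> R) :
  tame R phi -> inX x -> posf L -> 0 < e -> (forall k, orbit_hull x (y k)) ->
  exists i j, (i < j)%N /\ L (fun t => `|y i t - y j t|) < e.
Proof.
move=> htame cx hL e0 hy.
have cxi n : inX (fun t => x (iter n phi t)) by exact: inX_iter.
have [M M0 xM] := inX_bounded hT cx.
have l10 : 0 <= L (fun _ => 1) by case: hL => _ _; apply; exact: cpos_cst.
have e8 : 0 < e / 8 by lra.
have [N0 hN0] := orbit_totally_bounded htame cx hL e8.
have [m hm] : exists m : nat -> 'I_N0.+1, forall n,
    L (fun t => `|x (iter n phi t) - x (iter (m n) phi t)|) < e / 8.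
  have ex n : exists m : 'I_N0.+1,
      L (fun t => `|x (iter n phi t) - x (iter m phi t)|) < e / 8.
    by have [m mN hm] := hN0 n; exists (Ordinal (mN : (m < N0.+1)%N)).
  by have [m] := choice ex; exists m.
have [N hN] := choice hy; have [c hc] := choice hN.
(* [d k l] collects the coefficients of the iterates represented by the [l]-th one. *)
pose d k (l : 'I_N0.+1) := \sum_(n < N k | m n == l) c k n.
have d2 k l : `|d k l| <= 2.
  have [c2 _] := hc k; apply: le_trans c2; apply: le_trans (ler_norm_sum _ _ _) _.
  by rewrite big_mkcond/=; apply: ler_sum => n _; case: ifP.
(* With mesh [e / (4 * q)] the coefficient errors cost at most [e / 4] under [L]; two replacement
   errors of [e / 4] keep the total below [e]. *)
pose q := N0.+1%:R * (M * (L (fun _ => 1) + 1)) + 1 : R.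
have q0 : 0 < q.
  by rewrite /q ltr_wpDl// !mulr_ge0// addr_ge0.
have eq0 : 0 < e / (4 * q) by rewrite divr_gt0// mulr_gt0.
have [i [j [ij dij]]] := pigeonhole_bounded eq0 d2.
exists i, j; split=> //.
pose y' k t := \sum_l d k l * x (iter (nat_of_ord l) phi t).
have y'E k t : y' k t = \sum_(n < N k) c k n * x (iter (m n) phi t).
  rewrite (partition_big (fun n : 'I_(N k) => m n) xpredT)//=.
  by apply: eq_bigr => l _; rewrite mulr_suml; apply: eq_bigr => n /eqP ->.
have cy k : inX (y k) by exact: inX_orbit_hull (hy k).
have cy' k : inX (y' k).
  have -> : y' k = fun t => \sum_(n < N k) c k n * x (iter (m n) phi t).
    by apply/funext => t; exact: y'E.
  by apply: (@inX_sum _ _ (N k) (fun n t => c k n * x (iter (m n) phi t))) => n;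
    exact: inX_scale.
have yy' k : L (fun t => `|y k t - y' k t|) <= e / 4.
  have [c2 yE] := hc k.
  pose h n t := `|c k n| * `|x (iter n phi t) - x (iter (m n) phi t)|.
  have ch n : cpos (h n).
    by apply: cpos_scale => //; apply: cpos_abs; exact: inX_sub.
  apply: (@le_trans _ _ (L (fun t => \sum_(n < N k) h n t))).
    apply: posf_le => //; [apply: cpos_abs; exact: inX_sub|exact: cpos_sum|].
    move=> t; rewrite yE y'E -sumrB; apply: le_trans (ler_norm_sum _ _ _) _.
    by apply: ler_sum => n _; rewrite -mulrBr normrM.
  rewrite posf_sum//.
  apply: (@le_trans _ _ (\sum_(n < N k) `|c k n| * (e / 8))).
    apply: ler_sum => n _; case: (hL) => _ LZ _; rewrite [L (h n)]LZ//; last first.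
      by apply: cpos_abs; exact: inX_sub.
    by apply: ler_wpM2l => //; apply: ltW; exact: hm.
  rewrite -mulr_suml (_ : e / 4 = 2 * (e / 8)); last by field.
  by apply: ler_wpM2r => //; exact: ltW.
have y'ij : L (fun t => `|y' i t - y' j t|) <= e / 4.
  pose r := N0.+1%:R * (e / (4 * q) * M).
  have r0 : 0 <= r by apply: mulr_ge0 => //; apply: mulr_ge0 => //; exact: ltW.
  apply: le_trans (posf_bound hL r0 _ _) _.
  - by apply: cpos_abs; exact: inX_sub.
  - move=> t; rewrite -sumrB; apply: le_trans (ler_norm_sum _ _ _) _.
    apply: (@le_trans _ _ (\sum_(l < N0.+1) (e / (4 * q) * M))).
      by apply: ler_sum => l _; rewrite -mulrBl normrM; exact: ler_pM.
    by rewrite sumr_const card_ord -[leLHS]mulr_natl.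
  rewrite (_ : e / 4 = e / (4 * q) * q); last by field; rewrite gt_eqF.
  rewrite /r -mulrA -mulrA mulrCA; apply: ler_wpM2l; first exact: ltW.
  have aM : 0 <= N0.+1%:R * M by exact: mulr_ge0.
  rewrite /q; move: aM; move: N0.+1%:R (L _) => p l; lra.
have := posf_dist_triangle hL (cy i) (cy' i) (cy j).
have := posf_dist_triangle hL (cy' i) (cy' j) (cy j).
have := yy' j; rewrite (_ : (fun t => `|y j t - y' j t|) = fun t => `|y' j t - y j t|).
  by have := yy' i; lra.
by apply/funext => t; rewrite distrC.
Qed.

End OrbitHull.

(** * Greedy choice of a separated sequence along a filter *)

Section Separation.
Variables (I : Type) (G : set_system I) (Q : I -> I -> Prop).

Lemma filter_separated_sequence : ProperFilter G ->
  (forall i, \forall j \near G, Q i j) ->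
  exists u : nat -> I, forall i j, (i < j)%N -> Q (u i) (u j).
Proof.
move=> GF hQ.
have near_all (l : seq I) : \forall j \near G, forall i, List.In i l -> Q i j.
  elim: l => [|i l IH]; first by apply: filterS filterT.
  by apply: filterS (filterI (hQ i) IH) => j [ij lj] k [<-//|/lj].
pose step (l l' : seq I) := exists j, l' = j :: l /\ forall i, List.In i l -> Q i j.
have stepP l : {l' | step l l'}.
  by apply: cid; have [j hj] := filter_ex (near_all l); exists (j :: l), j.
have [h [h0 hS]] := dependent_choice stepP [::].
have [u hu] := choice hS; exists u => i j ij.
have uin : List.In (u i) (h j).
  elim: j ij => // j IH; rewrite ltnS leq_eqVlt (hu j).1.
  by case/orP => [/eqP ->|/IH ?]; [left|right].
exact: (hu j).2.
Qed.

End Separation.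

(** * Convergence in the hull, for sequences and for nets *)

Section OrbitHullConvergence.
Variables (R : realType) (T : metricType R) (phi : T -> T).
Hypothesis hT : compact [set: T].
Hypothesis cphi : continuous phi.
Hypothesis htame : tame R phi.
Variable x : T -> R.
Hypothesis cx : inX x.

Lemma orbit_hull_not_indep (y : nat -> T -> R) (a b : R) : a < b ->
  (forall k, orbit_hull phi x (y k)) ->
  ~ indep (fun k => [set t | b < y k t]) (fun k => [set t | y k t < a]).
Proof.
move=> ab hy hind; have cy k := inX_orbit_hull cphi cx (hy k).
have [L hL sep] := indep_separated hT ab cy hind.
have ab2 : 0 < (b - a) / 2 by rewrite divr_gt0// subr_gt0.
have [i [j [ij]]] := orbit_hull_not_separated hT cphi htame cx hL ab2 hy.
by rewrite ltNge sep.
Qed.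

Lemma orbit_hull_convergent_subset (y : nat -> T -> R) (A : set nat) :
  (forall k, orbit_hull phi x (y k)) -> unbounded A ->
  exists B, [/\ unbounded B, B `<=` A & forall s, cvg (y ^~ s @ within B \oo)].
Proof.
move=> hy; have [W [oW hW]] := exists_countable_base hT.
have [M _ xM] := inX_bounded hT cx.
apply: (pointwise_convergent_subset oW hW) => [k|k t|a b u ab _].
- exact: inX_orbit_hull (hy k).
- exact: orbit_hull_bound (hy k) t.
- by apply: orbit_hull_not_indep => // k; exact: hy.
Qed.

Section Nets.
Variables (I : Type) (w : I -> T -> R) (L : (T -> R) -> R) (K : set T).
Hypothesis hw : forall i, orbit_hull phi x (w i).
Hypothesis hL : posf L.
Hypothesis clK : closed K.
Hypothesis LK : forall y, cpos y -> (forall t, K t -> y t = 0) -> L y = 0.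

Let l1 := L (fun _ => 1).
Let cw i : inX (w i) := inX_orbit_hull cphi cx (hw i).

(** Otherwise each [i] would be [e]-far from [G]-almost all indices, and a greedy choice would give
    a separated sequence in the hull. *)
Lemma orbit_hull_ultra_cauchy (G : set_system I) (e : R) :
  UltraFilter G -> 0 < e ->
  exists i0, \forall i \near G, L (fun t => `|w i0 t - w i t|) < e.
Proof.
move=> GU e0; apply: contrapT => no.
have far i : \forall j \near G, e <= L (fun t => `|w i t - w j t|).
  have [near|] := in_ultra_setVsetC [set j | L (fun t => `|w i t - w j t|) < e] GU.
    by case: no; exists i.
  by apply: filterS => j /= /negP; rewrite -leNgt.
have [u hu] := filter_separated_sequence _ far.
have [i [j [ij]]] := orbit_hull_not_separated hT cphi htame cx hL e0 (fun k => hw (u k)).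
by rewrite ltNge hu.
Qed.

Section UltraContradiction.
Variables (G : set_system I) (b : R).
Hypothesis GU : UltraFilter G.
Hypothesis b0 : 0 < b.
Hypothesis w0 : forall t, K t -> w ^~ t @ G --> 0.

Let v i t := Num.max 0 (`|w i t| - b).
Let cv i : cpos (v i).
Proof. by apply: cpos_pospart; exact: inX_abs. Qed.

(** The weight [y] lives on [V] and still sees the excess of [|w i|] over [b]: a substitute for
    positive measure that uses continuous functions only. *)
Let good V := exists y (eta : R), [/\ cpos y, forall t, ~ V t -> y t = 0,
  0 < eta & \forall i \near G, eta <= L (fun t => y t * v i t)].

Let good_ne V : good V -> V !=set0.
Proof.
move=> [y [eta [cy yV eta0 hy]]]; apply: contrapT => V0.
have [i] := filter_ex hy; rewrite leNgt => /negP; apply.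
rewrite [X in L X](_ : _ = fun _ => 0) ?(posf0 hL)//.
by apply/funext => t; rewrite yV ?mul0r// => Vt; apply: V0; exists t.
Qed.

(** The new weight is [y * v i']. For [G]-almost all [i] and [i'] the functions [v i] and [v i'] are
    close under [L], so [y * v i' * v i] has nearly the integral of [y * v i ^+ 2]. *)
Let near_good_gt V : good V ->
  \forall i \near G, good (V `&` [set t | b / 2 < `|w i t|]).
Proof.
move=> [y [eta [cy yV eta0 hy]]].
have [Y Y0 yY] := inX_bounded hT cy.1.
have [M M0 xM] := inX_bounded hT cx.
have wM i t : `|w i t| <= 2 * M by exact: orbit_hull_bound.
have vM i t : v i t <= 2 * M.
  by rewrite /v ge_max mulr_ge0//= lerBlDr; apply: le_trans (wM i t) _; rewrite lerDl ltW.
have l10 : 0 <= l1 by case: hL => _ _; apply; exact: cpos_cst.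
(* [tau] makes the error [tau ^+ 2 * (Y * l1)] at most [tau * eta], and [d] makes [q * d] at most
   half of that; of [2 * tau * eta] there remains [tau * eta / 2]. *)
pose tau := eta / (Y * l1 + 1).
have d0 : 0 < Y * l1 + 1 by rewrite ltr_wpDl// mulr_ge0.
have tau0 : 0 < tau by rewrite divr_gt0.
pose q := Y * (2 * M).
have q0 : 0 <= q by rewrite !mulr_ge0.
pose d := tau * eta / (2 * (q + 1)).
have dd0 : 0 < d.
  by apply: divr_gt0; [exact: mulr_gt0|lra].
have d20 : 0 < d / 2 by rewrite divr_gt0.
have [i0 hi0] := orbit_hull_ultra_cauchy GU d20.
pose S := [set i | L (fun t => `|w i0 t - w i t|) < d / 2] `&`
          [set i | eta <= L (fun t => y t * v i t)].
have GS : G S by exact: filterI.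
apply: filterS (GS) => i' [/= ci' _].
exists (fun t => y t * v i' t), (tau * eta / 2); split.
- exact: cpos_mul.
- move=> t nV; have [Vt|nVt] := pselect (V t); last by rewrite yV ?mul0r.
  rewrite /v max_l ?mulr0// subr_le0 leNgt; apply/negP => bw.
  apply: nV; split=> //=; move: b0 bw.
  lra.
- by rewrite divr_gt0// mulr_gt0.
apply: filterS GS => i [/= ci hyi].
have cd : cpos (fun t => `|w i' t - w i t|) by apply: cpos_abs; exact: inX_sub.
have close : L (fun t => `|w i' t - w i t|) <= d.
  have := posf_dist_triangle hL (@cw i') (@cw i0) (@cw i).
  rewrite (_ : (fun t => `|w i' t - w i0 t|) = (fun t => `|w i0 t - w i' t|)); first lra.
  by apply/funext => t; rewrite distrC.
have : (tau + tau) * L (fun t => y t * v i t) <=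
    L (fun t => y t * v i' t * v i t) + (tau ^+ 2 * (Y * l1) + q * d).
  case: (hL) => LD LZ _.
  have tt0 : 0 <= tau + tau by rewrite addr_ge0// ltW.
  have cyv j : cpos (fun t => y t * v j t) by exact: cpos_mul.
  have cyvv : cpos (fun t => y t * v i' t * v i t) by exact: cpos_mul.
  have t2 : 0 <= tau ^+ 2 by rewrite exprn_ge0// ltW.
  have cty : cpos (fun t => tau ^+ 2 * y t) by exact: cpos_scale.
  have cqd : cpos (fun t => q * `|w i' t - w i t|) by exact: cpos_scale.
  apply: (@le_trans _ _ (L (fun t => y t * v i' t * v i t) +
      (L (fun t => tau ^+ 2 * y t) + L (fun t => q * `|w i' t - w i t|)))).
    rewrite -LZ// -LD// -LD//; last exact: cpos_add.
    apply: posf_le => //; [exact: cpos_scale|by apply: cpos_add => //; exact: cpos_add|].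
    move=> t; have yt0 := cy.2 t; have yt := le_trans (ler_norm _) (yY t).
    have vt0 := (@cv i).2 t; have vt := vM i t.
    have vv : v i t - v i' t <= `|w i' t - w i t|.
      rewrite /v; have := ler_normD (w i t - w i' t) (w i' t); rewrite subrK distrC.
      by have := normr_ge0 (w i' t - w i t); rewrite /Num.max;
        case: (ltP 0 (`|w i t| - b)) => ?; case: (ltP 0 (`|w i' t| - b)) => *; lra.
    have h3 : y t * v i t * (v i t - v i' t) <= q * `|w i' t - w i t|.
      apply: (@le_trans _ _ (y t * v i t * `|w i' t - w i t|)).
        by apply: ler_wpM2l => //; exact: mulr_ge0.
      by apply: ler_wpM2r => //; exact: ler_pM.
    (* Expanding the square bounds [y * v i ^+ 2] below by a term linear in [v i], whose integral is
       controlled. *)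
    have h4 : 0 <= y t * (v i t - tau) ^+ 2 by rewrite mulr_ge0// sqr_ge0.
    lra.
  apply: lerD => //; apply: lerD.
    rewrite LZ//; apply: ler_wpM2l => //; apply: posf_bound => // t.
    exact: le_trans (ler_norm _) (yY t).
  by rewrite LZ//; exact: ler_wpM2l.
have h5 : tau ^+ 2 * (Y * l1) <= tau * eta.
  rewrite expr2 -mulrA; apply: ler_wpM2l; first exact: ltW.
  by rewrite /tau mulrAC ler_pdivrMr// ler_pM2l// lerDl.
have h6 : q * d <= tau * eta / 2.
  rewrite /d mulrA ler_pdivrMr; last by lra.
  have -> : tau * eta / 2 * (2 * (q + 1)) = q * (tau * eta) + tau * eta by field.
  by rewrite lerDl mulr_ge0// ltW.
have h7 : tau * eta <= tau * L (fun t => y t * v i t) by rewrite ler_pM2l.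
have h8 : tau * eta = tau * eta / 2 + tau * eta / 2 by exact: splitr.
by rewrite mulrDl; lra.
Qed.

(** Since [w i t] tends to 0, the open set [|w i| < b / 4] eventually contains [t]. *)
Let local_limit_good V (t : T) : V t -> K t ->
  (forall O, open O -> O t -> good (V `&` O)) ->
  \forall i \near G, good (V `&` [set s | `|w i s| < b / 4]).
Proof.
move=> Vt Kt hO; have /cvgrPdist_lt/(_ (b / 4)) := w0 Kt.
have b4 : 0 < b / 4 by rewrite divr_gt0.
move=> /(_ b4); apply: filterS => i; rewrite sub0r normrN => wit.
by apply: hO => //; apply: open_lt; exact: inX_abs.
Qed.

(* If no point of [V] kept [V] good in all its neighbourhoods, a partition of
   unity on [y >= delta] would make [L ((y - delta)^+ * v i)] tend to 0. *)
Let near_good_lt V : good V ->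
  \forall i \near G, good (V `&` [set t | `|w i t| < b / 4]).
Proof.
move=> [y [eta [cy yV eta0 hy]]]; apply: contrapT => nogood.
have noO t : V t -> K t -> exists2 O, open O /\ O t & ~ good (V `&` O).
  move=> Vt Kt; apply: contrapT => hO; apply: nogood.
  apply: (local_limit_good Vt Kt) => O oO Ot; apply: contrapT => nO.
  by apply: hO; exists O.
have [M M0 xM] := inX_bounded hT cx.
have wM i t : `|w i t| <= 2 * M by exact: orbit_hull_bound.
have vM i t : v i t <= 2 * M.
  by rewrite /v ge_max mulr_ge0//= lerBlDr; apply: le_trans (wM i t) _; rewrite lerDl ltW.
have l10 : 0 <= l1 by case: hL => _ _; apply; exact: cpos_cst.
pose q := 2 * M * l1.
have q0 : 0 <= q by rewrite !mulr_ge0.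
pose d := eta / (2 * (q + 1)).
have d0 : 0 < d by apply: divr_gt0 => //; lra.
have dq : d * q <= eta / 2.
  rewrite /d mulrAC ler_pdivrMr; last by lra.
  have -> : eta / 2 * (2 * (q + 1)) = eta * q + eta by field.
  by rewrite lerDl ltW.
(* Cutting [y] at height [d] costs at most [eta / 2] and leaves a weight that vanishes on the open
   set [y < d], hence near every point outside [V]. *)
pose z t := Num.max 0 (y t - d).
have cz : cpos z by apply: cpos_pospart; case: cy.
have hz : \forall i \near G, eta / 2 <= L (fun t => z t * v i t).
  apply: filterS hy => i hi.
  have : L (fun t => y t * v i t) <= L (fun t => z t * v i t) + d * q.
    have czv : cpos (fun t => z t * v i t) by exact: cpos_mul.
    have cdv : cpos (fun t => d * v i t) by apply: cpos_scale => //; exact: ltW.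
    apply: (@le_trans _ _ (L (fun t => z t * v i t + d * v i t))).
      apply: posf_le => //; [exact: cpos_mul|exact: cpos_add|move=> t].
      rewrite -mulrDl; apply: ler_wpM2r; first by case: (@cv i).
      by rewrite -lerBlDr le_max lexx orbT.
    case: (hL) => LD LZ _; rewrite LD// LZ//; last exact: ltW.
    rewrite lerD2l; apply: ler_wpM2l; first exact: ltW.
    by rewrite /q; apply: posf_bound => //; rewrite mulr_ge0.
  by lra.
have cbump t r : cpos (fun s => Num.max 0 (r - mdist t s)).
  apply: cpos_max; first exact: cpos_cst.
  by apply: inX_sub; [exact: inX_cst|exact: inX_mdist].
have cterm t r i : cpos (fun s => Num.max 0 (r - mdist t s) * z s * v i s).
  by apply: cpos_mul => //; exact: cpos_mul.
(* Three kinds of point: off [K] the functional sees nothing; where [y t < d] the weight [z]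
   vanishes nearby; otherwise [t] lies in [V] and [K], and the failure of goodness near [t] forces
   the integrals to 0. *)
have small t : exists r, 0 < r /\ forall e, 0 < e ->
    \forall i \near G, L (fun s => Num.max 0 (r - mdist t s) * z s * v i s) < e.
  have reduce (P : set T) : open P -> P t ->
      (forall r, (forall s, ~ P s -> Num.max 0 (r - mdist t s) = 0) ->
        forall e, 0 < e ->
        \forall i \near G, L (fun s => Num.max 0 (r - mdist t s) * z s * v i s) < e) ->
      exists r, 0 < r /\ forall e, 0 < e ->
    \forall i \near G, L (fun s => Num.max 0 (r - mdist t s) * z s * v i s) < e.
    move=> oP Pt h; have := open_nbhs_nbhs (conj oP Pt).
    rewrite -nbhs_ballE => -[r /= r0]; rewrite ballEmdist => hr.
    exists r; split=> //; apply: h => s nPs; rewrite max_l// subr_le0 leNgt.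
    by apply/negP => ts; apply: nPs; exact: hr.
  have [Kt|nKt] := pselect (K t); last first.
    apply: (reduce (~` K)) => // [|r hr e e0]; first exact: closed_openC.
    apply: filterS filterT => i _; rewrite LK// => s Ks.
    by rewrite hr ?mul0r//; exact.
  have [yd|dy] := ltP (y t) d.
    apply: (reduce [set s | y s < d]) => // [|r hr e e0].
      by apply: open_lt; case: cy.
    apply: filterS filterT => i _; rewrite [X in L X](_ : _ = fun _ => 0).
      by rewrite (posf0 hL).
    apply/funext => s; have [ys|ys] := ltP (y s) d.
      by rewrite /z (@max_l _ _ 0 (y s - d)) ?mulr0 ?mul0r// subr_le0 ltW.
    by rewrite hr ?mul0r//=; apply/negP; rewrite -leNgt.
  have Vt : V t.
    by apply: contrapT => /yV yt; move: dy; rewrite yt leNgt d0.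
  have [P [oP Pt] nP] := noO t Vt Kt.
  apply: (reduce P) => // r hr e e0.
  have [//|big] := in_ultra_setVsetC
    [set i | L (fun s => Num.max 0 (r - mdist t s) * z s * v i s) < e] GU.
  case: nP; exists (fun s => Num.max 0 (r - mdist t s) * z s), e; split=> //.
  - exact: cpos_mul.
  - move=> s nVO; have [Ps|nPs] := pselect (P s); last by rewrite hr ?mul0r.
    rewrite /z (@max_l _ _ 0 (y s - d)) ?mulr0// subr_le0 yV ?ltW// => Vs.
    by apply: nVO.
  by apply: filterS big => i /= /negP; rewrite -leNgt.
have [r hr] := choice small.
have [t|t|l hl] := compact_seq_cover hT (O := fun t => [set s | mdist t s < r t / 2]).
- exact: open_mdist_lt.
- by rewrite /= mdistxx divr_gt0//; case: (hr t).
pose g t i s := Num.max 0 (r t - mdist t s) * z s * v i s.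
have csum (k : seq T) i : cpos (fun s => \sum_(t <- k) g t i s).
  elim: k => [|t k IH].
    rewrite (_ : (fun s => _) = fun _ => 0); first exact: cpos_cst.
    by apply/funext => s; rewrite big_nil.
  rewrite (_ : (fun s => _) = fun s => g t i s + \sum_(t <- k) g t i s).
    by apply: cpos_add => //; exact: cterm.
  by apply/funext => s; rewrite big_cons.
have sums (k : seq T) e : 0 < e ->
    \forall i \near G, L (fun s => \sum_(t <- k) g t i s) < e.
  elim: k e => [|t k IH] e e0.
    apply: filterS filterT => i _.
    rewrite [X in L X](_ : _ = fun _ => 0) ?(posf0 hL)//.
    by apply/funext => s; rewrite big_nil.
  have e2 : 0 < e / 2 by rewrite divr_gt0.
  apply: filterS (filterI ((hr t).2 _ e2) (IH _ e2)) => i [h1 h2].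
  rewrite [X in L X](_ : _ = fun s => g t i s + \sum_(t <- k) g t i s).
    by case: (hL) => -> //; [rewrite [ltRHS]splitr ltrD|exact: cterm].
  by apply/funext => s; rewrite big_cons.
(* Each bump is at least [rho] on the ball of half its radius, so the finite sum of bumps is at
   least [rho] everywhere. *)
have [rho rho0 hrho] : exists2 rho : R, 0 < rho & forall t, t \in l -> (rho <= r t / 2)%R.
  elim: (l) => [|u l' [r1 r10 hr1]]; first by exists 1.
  exists (Num.min (r u / 2) r1).
    by rewrite lt_min r10 andbT divr_gt0//; case: (hr u).
  move=> t; rewrite inE ge_min => /orP[/eqP ->|/hr1 ->]; first by rewrite lexx.
  by rewrite orbT.
have re0 : 0 < rho * (eta / 2) by rewrite mulr_gt0// divr_gt0.
have [i [/= hi]] := filter_ex (filterI (sums l _ re0) hz).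
rewrite leNgt => /negP; apply; rewrite -(ltr_pM2l rho0); apply: le_lt_trans hi.
case: (hL) => _ LZ _; rewrite -LZ; [|exact: ltW|exact: cpos_mul].
apply: posf_le => //.
  by apply: cpos_scale; [exact: ltW|exact: cpos_mul].
move=> s; have [t tl ts] := hl s; rewrite (big_rem t)//= -[leLHS]addr0.
apply: lerD; last by apply: sumr_ge0 => u _; exact: (cterm u (r u) i).2.
rewrite /g mulrA; apply: ler_wpM2r; first by case: (@cv i).
apply: ler_wpM2r; first by case: cz.
have := hrho t tl; rewrite le_max => ?; apply/orP; right.
move: ts => /=; lra.
Qed.

(** The whole space would be good, and goodness would propagate to an independent sequence
    [|w (u k)|] with levels [b / 4 < b / 2]. Its separation contradicts total boundedness of the
    hull. *)
Lemma ultra_limit_not_above : ~ \forall i \near G, b * (l1 + 1) <= L (fun t => `|w i t|).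
Proof.
move=> hbig.
have l10 : 0 <= l1 by case: hL => _ _; apply; exact: cpos_cst.
have goodT : good setT.
  (* Removing the part below [b] costs at most [b * l1] of the assumed [b * (l1 + 1)], which leaves
     [b]. *)
  exists (fun _ => 1), b; split=> //; [exact: cpos_cst|by move=> t []|].
  apply: filterS hbig => i hi.
  have : L (fun t => `|w i t|) <= L (fun t => 1 * v i t) + b * l1.
    have c1 : cpos (fun t => 1 * v i t) by apply: cpos_scale.
    have cb : cpos (fun _ : T => b * 1) by apply: cpos_cst; rewrite mulr1 ltW.
    apply: (@le_trans _ _ (L (fun t => 1 * v i t + b * 1))).
      apply: posf_le => //; [exact: cpos_abs (@cw i)|exact: cpos_add|move=> t].
      by rewrite mul1r mulr1 -lerBlDr le_max lexx orbT.
    case: (hL) => LD LZ _; rewrite LD// (LZ b (fun _ => 1))//; first exact: ltW.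
    exact: cpos_cst.
  by lra.
have hQ (i : I) : \forall j \near G, True by exact: filterT.
have [u [_ hu]] :=
  independent_sequence (@ultra_proper _ _ GU) goodT good_ne near_good_gt near_good_lt hQ.
have b42 : b / 4 < b / 2 by move: b0; lra.
have cu k : inX (fun t => `|w (u k) t|) by exact: inX_abs.
have [L' hL' sep] := indep_separated hT b42 cu hu.
have e0 : 0 < (b / 2 - b / 4) / 2 by move: b0; lra.
have [i [j [ij]]] := orbit_hull_not_separated hT cphi htame cx hL' e0 (fun k => hw (u k)).
rewrite ltNge => /negP; apply; apply: le_trans (sep i j ij) _.
have cd y y' : inX y -> inX y' -> cpos (fun t => `|y t - y' t|).
  by move=> cy cy'; apply: cpos_abs; exact: inX_sub.
apply: posf_le => //; [exact: cd|exact: cd|].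
(* The reverse triangle inequality carries the separation of the absolute values over to the
   [w (u k)], which lie in the hull. *)
by move=> t; exact: ler_dist_dist.
Qed.

End UltraContradiction.
(* Bounded convergence for nets fails without tameness. *)
Lemma orbit_hull_net_cvg (F : set_system I) : ProperFilter F ->
  (forall t, K t -> w ^~ t @ F --> 0) ->
  (fun i => L (fun t => `|w i t|)) @ F --> 0.
Proof.
move=> FF w0; apply: ultra_cvg => G GU FG.
have l10 : 0 <= l1 by case: hL => _ _; apply; exact: cpos_cst.
apply/cvgrPdist_lt => e e0.
pose b := e / (l1 + 1).
have b0 : 0 < b by apply: divr_gt0 => //; lra.
have w0G t : K t -> w ^~ t @ G --> 0.
  by move=> /w0; apply: cvg_trans => A; exact: FG.
have [|big] := in_ultra_setVsetC [set i | L (fun t => `|w i t|) < e] GU.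
  apply: filterS => i /= wi; rewrite sub0r normrN ger0_norm//.
  by case: hL => _ _; apply; exact: cpos_abs.
case: (ultra_limit_not_above GU b0 w0G); apply: filterS big => i /= /negP.
by rewrite -leNgt /b mulfVK// gt_eqF// ltr_wpDl.
Qed.

End Nets.
End OrbitHullConvergence.

(** * Nets as filters of tails *)

Section Nets.
Variables (R : realType) (D : Type) (le : D -> D -> Prop).
Hypothesis dir : directed le.

Definition tails : set_system D := filter_from setT (fun i0 => [set i | le i0 i]).

Lemma tails_proper : ProperFilter tails.
Proof.
have [rfl [trans [[i0 _] up]]] := dir.
apply: filter_from_proper; last by move=> i _; exists i; exact: rfl.
apply: filter_from_filter; first by exists i0.
move=> i j _ _; have [k [ik jk]] := up i j; exists k => // l /= kl.
by split; [exact: trans kl|exact: trans kl].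
Qed.

Lemma net_cvgP (r : D -> R) (l : R) : net_cvg le r l <-> r @ tails --> l.
Proof.
have FF := tails_proper; split=> [h|/cvgrPdist_lt h e e0].
  apply/cvgrPdist_lt => e e0; have [i0 hi] := h e e0.
  by exists i0 => // i /= /hi; rewrite distrC.
by have [i0 _ hi] := h e e0; exists i0 => i /hi /=; rewrite distrC.
Qed.

End Nets.

(** * Convex combinations of the powers of [Vop phi], and limits of ergodic nets *)

Section Operators.
Variables (R : realType) (T : metricType R) (phi : T -> T).
Hypothesis hT : compact [set: T].
Hypothesis cphi : continuous phi.
Implicit Types (x y : T -> R) (mu nu : (T -> R) -> R).

Lemma iter_Vop n mu x : iter n (Vop phi) mu x = mu (fun t => x (iter n phi t)).
Proof.
elim: n x => [//|n IH] x /=; rewrite /Vop IH; congr mu.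
Qed.

(** These operators are adjoints: their action on Dirac functionals is a continuous function, and
    integrating it recovers the action on every [mu]. *)
Lemma in_coV_eval (A : ((T -> R) -> R) -> ((T -> R) -> R)) x : in_coV phi A ->
  inX x -> exists N (c : nat -> R), [/\ forall n, 0 <= c n, \sum_(n < N) c n = 1,
    forall t, A (fun y => y t) x = \sum_(n < N) c n * x (iter n phi t) &
    forall mu, inXstar mu -> A mu x = mu (fun t => A (fun y => y t) x)].
Proof.
move=> [N [c [c0 [c1 hA]]]] cx; exists N, c.
have E t : A (fun y => y t) x = \sum_(n < N) c n * x (iter n phi t).
  rewrite hA//; last exact: inXstar_eval.
  by apply: eq_bigr => n _; rewrite iter_Vop.
split=> // mu hmu; rewrite hA//.
have -> : (fun t => A (fun y => y t) x) = fun t => \sum_(n < N) c n * x (iter n phi t).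
  by apply/funext => t; exact: E.
rewrite (inXstar_sum hmu N (f := fun n t => c n * x (iter n phi t))); last first.
  by move=> n; apply: inX_scale; exact: inX_iter.
apply: eq_bigr => n _; rewrite iter_Vop (inXstar_scale hmu)//.
exact: inX_iter.
Qed.

(** The difference of two convex combinations has total absolute weight at most 2, once both are
    padded with zeros to a common length. *)
Lemma in_coV_dist_hull (A A' : ((T -> R) -> R) -> ((T -> R) -> R)) x :
  in_coV phi A -> in_coV phi A' -> inX x ->
  orbit_hull phi x (fun t => A (fun y => y t) x - A' (fun y => y t) x).
Proof.
move=> hA hA' cx.
have [N [c [c0 c1 cE _]]] := in_coV_eval hA cx.
have [N' [c' [c0' c1' cE' _]]] := in_coV_eval hA' cx.
pose b n := (if (n < N)%N then c n else 0) - (if (n < N')%N then c' n else 0).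
have trunc (M : nat) (d : nat -> R) (g : nat -> R) : (M <= maxn N N')%N ->
    \sum_(n < maxn N N') (if (n < M)%N then d n else 0) * g n =
    \sum_(n < M) d n * g n.
  move=> le; rewrite (big_ord_widen _ (fun n => d n * g n) le) [RHS]big_mkcond/=.
  by apply: eq_bigr => n _; case: ifP => _ //; rewrite mul0r.
exists (maxn N N'), b; split.
  apply: (@le_trans _ _ (\sum_(n < maxn N N') ((if (n < N)%N then c n else 0) * 1 +
      (if (n < N')%N then c' n else 0) * 1))).
    apply: ler_sum => n _; rewrite !mulr1; apply: le_trans (ler_normB _ _) _.
    by apply: lerD; case: ifP => _; rewrite ?normr0 ?ger0_norm.
  rewrite big_split/= (trunc N c (fun _ => 1)) ?leq_maxl//.
  rewrite (trunc N' c' (fun _ => 1)) ?leq_maxr//.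
  under eq_bigr do rewrite mulr1; under [X in _ + X]eq_bigr do rewrite mulr1.
  by rewrite c1 c1'.
apply/funext => t; rewrite cE cE' -(trunc N c (fun n => x (iter n phi t)))?leq_maxl//.
rewrite -(trunc N' c' (fun n => x (iter n phi t)))?leq_maxr// -sumrB.
by apply: eq_bigr => n _; rewrite mulrBl.
Qed.

Lemma in_coV_hull (A : ((T -> R) -> R) -> ((T -> R) -> R)) x :
  in_coV phi A -> inX x -> orbit_hull phi x (fun t => A (fun y => y t) x).
Proof.
move=> hA cx; have [N [c [c0 c1 cE _]]] := in_coV_eval hA cx.
exists N, c; split; last by apply/funext.
rewrite (eq_bigr (fun n : 'I_N => c n)) ?c1 ?ler1n// => n _.
by rewrite ger0_norm.
Qed.

Lemma in_coV_bound (A : ((T -> R) -> R) -> ((T -> R) -> R)) mu x (c : R) :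
  in_coV phi A -> inXstar mu -> inX x -> 0 <= c ->
  (forall y, inX y -> `|mu y| <= c * supnorm y) -> `|A mu x| <= c * supnorm x.
Proof.
move=> hA hmu cx c0 hc; have [N [a [a0 a1 aE ->//]]] := in_coV_eval hA cx.
have ch := inX_orbit_hull cphi cx (in_coV_hull hA cx).
apply: le_trans (hc _ ch) _; apply: ler_wpM2l => //.
apply: supnorm_le => [|t]; first exact: supnorm_ge0.
rewrite aE; apply: le_trans (ler_norm_sum _ _ _) _.
apply: (@le_trans _ _ (\sum_(n < N) a n * supnorm x)).
  apply: ler_sum => n _; rewrite normrM ger0_norm//.
  by apply: ler_wpM2l => //; exact: le_supnorm.
by rewrite -mulr_suml a1 mul1r.
Qed.

Section NetLimits.
Variables (D : Type) (le : D -> D -> Prop).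
Variable Va : D -> ((T -> R) -> R) -> ((T -> R) -> R).
Hypothesis dir : directed le.
Hypothesis erg : ergodic_net phi le Va.

(** Limits inherit linearity, and contractivity of the net bounds the limit operator with constant
    1. *)
Lemma WSO_cvg_pointwise : (forall x mu, inX x -> inXstar mu ->
    cvg ((fun i => Va i mu x) @ tails le)) -> WSO_cvg le Va.
Proof.
move=> h; exists (fun mu x => lim ((fun i => Va i mu x) @ tails le)).
have FF := tails_proper dir; have [coV _] := erg.
have lin i (a : R) mu x y : inXstar mu -> inX x -> inX y ->
    Va i mu (fun t => a * x t + y t) = a * Va i mu x + Va i mu y.
  move=> hmu cx cy; have [N [c [_ [_ hV]]]] := coV i.
  have cxy : inX (fun t => a * x t + y t) by apply: inX_add => //; exact: inX_scale.
  rewrite !hV// mulr_sumr -big_split/=; apply: eq_bigr => n _.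
  by rewrite !iter_Vop inXstar_lin//; [ring|exact: inX_iter|exact: inX_iter].
have bnd mu x (c : R) : inXstar mu -> inX x -> 0 <= c ->
    (forall y, inX y -> `|mu y| <= c * supnorm y) ->
    `|lim ((fun i => Va i mu x) @ tails le)| <= c * supnorm x.
  move=> hmu cx c0 hc; apply: (cvgr_to_le (cvg_norm (h x mu cx hmu))).
  by apply: filterS filterT => i _; exact: in_coV_bound.
split; last first.
  by move=> x mu cx hmu; apply/(net_cvgP dir); exact: h.
split; last split.
- move=> mu hmu; split.
    move=> a x y cx cy; apply/cvg_lim => //.
    rewrite [X in X @ _](_ : _ = fun i => a * Va i mu x + Va i mu y).
      by apply: cvgD; [apply: cvgM; [exact: cvg_cst|exact: h]|exact: h].
    by apply/funext => i; exact: lin.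
  have [_ [M hM]] := hmu; exists `|M| => x cx; apply: bnd => // y cy.
  apply: le_trans (hM y cy) _; apply: ler_wpM2r; [exact: supnorm_ge0|exact: ler_norm].
- move=> a mu nu hmu hnu x cx; apply/cvg_lim => //.
  rewrite [X in X @ _](_ : _ = fun i => a * Va i mu x + Va i nu x).
    by apply: cvgD; [apply: cvgM; [exact: cvg_cst|exact: h]|exact: h].
  apply/funext => i; have [N [c [_ _ cE hV]]] := in_coV_eval (coV i) cx.
  rewrite (hV mu)// (hV nu)// hV//; split.
    move=> b y z cy cz; rewrite !inXstar_lin//; ring.
  have [_ [M hM]] := hmu; have [_ [M' hM']] := hnu; exists (`|a| * M + M') => y cy.
  apply: le_trans (ler_normD _ _) _; rewrite mulrDl; apply: lerD; last exact: hM'.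
  by rewrite normrM -mulrA; apply: ler_wpM2l => //; exact: hM.
- by exists 1 => mu c hmu c0 hc x cx; rewrite mul1r; exact: bnd.
Qed.

(* The difference of two members of the net lies in the hull, so the net
   [mu (w i)] is Cauchy as soon as [w i] converges pointwise. *)
Lemma WSO_cvg_of_Dirac : tame R phi ->
  (forall x t, inX x -> cvg ((fun i => Va i (fun y => y t) x) @ tails le)) ->
  WSO_cvg le Va.
Proof.
move=> htame h; apply: WSO_cvg_pointwise => x mu cx hmu.
have FF := tails_proper dir; have [coV _] := erg.
pose w i t := Va i (fun y => y t) x.
have cw i : inX (w i) by apply: inX_orbit_hull (in_coV_hull (coV i) cx).
have muE i : Va i mu x = mu (w i).
  by have [N [c [_ _ _ ->]]] := in_coV_eval (coV i) cx.
have [L [hL muL]] := total_variation hT hmu.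
pose W (p : D * D) t := w p.1 t - w p.2 t.
have hW p : orbit_hull phi x (W p) by exact: in_coV_dist_hull.
have FP : ProperFilter (filter_prod (tails le) (tails le)).
  exact: filter_prod_proper.
have W0 t : setT t -> W ^~ t @ filter_prod (tails le) (tails le) --> 0.
  move=> _; have /cvg_ex[l hl] := h x t cx.
  rewrite -(subrr l); apply: cvgB; first exact: cvg_comp (cvg_fst) hl.
  exact: cvg_comp (cvg_snd) hl.
have LT y : cpos y -> (forall t, setT t -> y t = 0) -> L y = 0.
  move=> _ y0; rewrite -[RHS](posf0 hL); congr L; apply/funext => t; exact: y0.
have /cvgrPdist_lt cL := orbit_hull_net_cvg hT cphi htame cx hW hL closedT LT FP W0.
apply/cauchy_cvgP/cauchy_ballP => e e0; have := cL e e0.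
rewrite near_simpl; apply: filterS => -[i j] /=; rewrite sub0r normrN => Lij.
rewrite /ball/= !muE -(inXstar_sub hmu)//; apply: le_lt_trans (muL _ _) _.
  exact: inX_sub.
by apply: le_lt_trans Lij; exact: ler_norm.
Qed.

(** Combinations of iterates evaluated at [w] only see its orbit, which gives the support condition;
    ergodicity of the net becomes invariance. *)
Lemma ultralimit_inv_prob (G : set_system D) (w : T) : UltraFilter G ->
  tails le `<=` G ->
  inv_prob_on phi (orbit_closure phi w)
    (fun x => lim ((fun i => Va i (fun y => y w) x) @ G)).
Proof.
move=> GU tG; have [coV er] := erg.
have hw : inXstar (fun y : T -> R => y w) by exact: inXstar_eval.
have vB i x : inX x -> `|Va i (fun y => y w) x| <= supnorm x.
  move=> cx; rewrite -[leRHS]mul1r; apply: in_coV_bound => // y cy.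
  by rewrite mul1r; exact: le_supnorm.
have cvG x : inX x -> (fun i => Va i (fun y => y w) x) @ G -->
    lim ((fun i => Va i (fun y => y w) x) @ G).
  by move=> cx; apply: ultra_bounded_cvg => i; exact: vB.
have eval i x : inX x -> exists N (c : nat -> R), [/\ forall n, 0 <= c n,
    \sum_(n < N) c n = 1 & Va i (fun y => y w) x = \sum_(n < N) c n * x (iter n phi w)].
  by move=> cx; have [N [c [? ? ? _]]] := in_coV_eval (coV i) cx; exists N, c.
split; [split|split; [|split; [|split]]].
- move=> a x y cx cy; apply/cvg_lim => //.
  rewrite [X in X @ _](_ : _ = fun i =>
      a * Va i (fun y => y w) x + Va i (fun y => y w) y).
    by apply: cvgD; [apply: cvgM; [exact: cvg_cst|exact: cvG]|exact: cvG].
  apply/funext => i; have [N [c [_ [_ hV]]]] := coV i.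
  have cxy : inX (fun t => a * x t + y t) by apply: inX_add => //; exact: inX_scale.
  rewrite !hV// mulr_sumr -big_split/=; apply: eq_bigr => n _.
  by rewrite !iter_Vop; ring.
- exists 1 => x cx; rewrite mul1r; apply: (cvgr_to_le (cvg_norm (cvG x cx))).
  by apply: filterS filterT => i _; exact: vB.
- move=> x cx x0; apply: cvgr_to_ge (cvG x cx) _.
  apply: filterS filterT => i _; have [N [c [c0 _ ->]]] := eval i x cx.
  by apply: sumr_ge0 => n _; exact: mulr_ge0.
- apply/cvg_lim => //; rewrite [X in X @ _](_ : _ = fun _ => 1); first exact: cvg_cst.
  apply/funext => i; have [N [c [_ c1 ->]]] := eval i _ (@inX_cst R T 1).
  by under eq_bigr do rewrite mulr1.
- move=> x cx x0; apply/cvg_lim => //.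
  rewrite [X in X @ _](_ : _ = fun _ => 0); first exact: cvg_cst.
  apply/funext => i; have [N [c [_ _ ->]]] := eval i x cx.
  apply: big1 => n _; rewrite x0 ?mulr0//; apply: subset_closure; by exists n.
- move=> x cx; have cxp := inX_comp cphi cx.
  have /(net_cvgP dir) h0 := er x _ cx hw.
  have /(cvgB (cvG x cx)) : (fun i => Va i (fun y => y w) x -
      Vop phi (Va i (fun y => y w)) x) @ G --> 0.
    by apply: cvg_trans h0 => A; exact: tG.
  rewrite subr0 => h1; apply/cvg_lim => //; apply: cvg_trans h1.
  apply: near_eq_cvg; apply: filterS filterT => i _ /=.
  by rewrite opprB addrC subrK.
Qed.

End NetLimits.
End Operators.

(** * Cesaro means over shifted windows *)

Section Cesaro.
Variables (R : realType) (T : metricType R) (phi : T -> T).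
Hypothesis hT : compact [set: T].
Hypothesis cphi : continuous phi.
Implicit Types (x y : T -> R) (mu nu : (T -> R) -> R).

(** The window has length [N] and starts at time [p]; a movable start is what later produces
    divergent ergodic sequences. *)
Definition cesaro (N p : nat) : ((T -> R) -> R) -> ((T -> R) -> R) :=
  fun mu x => N%:R^-1 * \sum_(n < N) mu (fun t => x (iter (p + n) phi t)).

Lemma cesaro_coV N p : (0 < N)%N -> in_coV phi (cesaro N p).
Proof.
move=> N0; have NR : N%:R != 0 :> R by rewrite pnatr_eq0 -lt0n.
exists (p + N)%N, (fun n => if (p <= n)%N then N%:R^-1 else 0).
have E (g : nat -> R) :
    \sum_(n < p + N) (if (p <= n)%N then N%:R^-1 else 0) * g n =
    N%:R^-1 * \sum_(n < N) g (p + n)%N.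
  rewrite big_split_ord/= big1 ?add0r => [|i _].
    by rewrite mulr_sumr; apply: eq_bigr => i _; rewrite leq_addr.
  by rewrite leqNgt ltn_ord mul0r.
split; first by move=> n; case: ifP.
split; last by move=> mu _ x _; rewrite (E (fun n => iter n (Vop phi) mu x));
  congr (_ * _); apply: eq_bigr => n _; rewrite iter_Vop.
have := E (fun _ => 1); under eq_bigr do rewrite mulr1; move=> ->.
by rewrite sumr_const card_ord mulVf.
Qed.

Lemma leq_directed : directed (fun m n : nat => (m <= n)%N).
Proof.
split=> //; split; first by move=> i j k; exact: leq_trans.
split; first by exists 0%N.
by move=> i j; exists (maxn i j); rewrite leq_maxl leq_maxr.
Qed.

(** The difference telescopes to the two ends of the window. The ball of radius [supnorm x], where
    [c] bounds [mu], contains all iterates of [x]. *)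
Lemma cesaro_almost_invariant N p mu x (c : R) : (forall y, inX y ->
    (forall t, `|y t| <= supnorm x) -> `|mu y| <= c) -> inX x ->
  `|cesaro N p mu x - Vop phi (cesaro N p mu) x| <= (c + c) / N%:R.
Proof.
move=> hc cx; have muB n : `|mu (fun t => x (iter n phi t))| <= c.
  by apply: hc => [|t]; [exact: inX_iter|exact: le_supnorm].
rewrite /Vop /cesaro -mulrBr -sumrB mulrC normrM normfV normr_nat.
apply: ler_wpM2r; first by rewrite invr_ge0.
have -> : \sum_(n < N) (mu (fun t => x (iter (p + n) phi t)) -
    mu (fun t => (x \o phi) (iter (p + n) phi t))) =
    mu (fun t => x (iter p phi t)) - mu (fun t => x (iter (p + N) phi t)).
  elim: N => [|N IH]; first by rewrite big_ord0 addn0 subrr.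
  by rewrite big_ord_recr/= IH addnS addrA subrK.
by apply: le_trans (ler_normB _ _) _; exact: lerD.
Qed.

Lemma cesaro_ergodic (N p : nat -> nat) : (forall k, (k < N k)%N) ->
  ergodic_net phi (fun m n : nat => (m <= n)%N) (fun k => cesaro (N k) (p k)).
Proof.
move=> hN; split=> [k|x mu cx hmu e e0].
  by apply: cesaro_coV; exact: leq_ltn_trans (hN k).
have [_ [M hM]] := hmu.
pose c := `|M| * supnorm x.
have c0 : 0 <= c by rewrite mulr_ge0// supnorm_ge0.
have hc y : inX y -> (forall t, `|y t| <= supnorm x) -> `|mu y| <= c.
  move=> cy yx; apply: le_trans (hM y cy) _.
  apply: le_trans (ler_wpM2r (supnorm_ge0 hT cy) (ler_norm M)) _.
  apply: ler_wpM2l => //; apply: supnorm_le => //; exact: supnorm_ge0.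
have q0 : 0 < e / (c + c + 1) by apply: divr_gt0 => //; lra.
have [n] := ltr_add_invr q0; rewrite add0r => hn.
exists n => k nk; rewrite subr0.
apply: le_lt_trans (cesaro_almost_invariant _ _ hc cx) _.
have kn : (N k)%:R^-1 <= n.+1%:R^-1 :> R.
  rewrite lef_pV2 ?posrE ?ltr0n ?ler_nat//; first exact: leq_ltn_trans (hN k).
  by apply: leq_trans (hN k).
apply: (@le_lt_trans _ _ ((c + c) * (e / (c + c + 1)))).
  by apply: ler_wpM2l; [exact: addr_ge0|apply: le_trans kn _; exact: ltW].
rewrite mulrA ltr_pdivrMr; last lra.
by rewrite mulrC ltr_pM2l//; lra.
Qed.

Lemma cesaro_Dirac_dist N p t x y (d : R) : (0 < N)%N ->
  (forall s, `|x s - y s| <= d) ->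
  `|cesaro N p (fun z => z t) x - cesaro N p (fun z => z t) y| <= d.
Proof.
move=> N0 xyd; rewrite /cesaro -mulrBr -sumrB mulrC normrM normfV normr_nat.
rewrite ler_pdivrMr ?ltr0n//; apply: le_trans (ler_norm_sum _ _ _) _.
apply: (@le_trans _ _ (\sum_(n < N) d)); first exact: ler_sum.
by rewrite sumr_const card_ord mulr_natr.
Qed.

Lemma cesaro_Dirac_sum N p t (m : nat) (c : nat -> R) (e : nat -> T -> R) :
  cesaro N p (fun z => z t) (fun s => \sum_(i < m) c i * e i s) =
  \sum_(i < m) c i * cesaro N p (fun z => z t) (e i).
Proof.
rewrite /cesaro exchange_big mulr_sumr; apply: eq_bigr => i _.
by rewrite [RHS]mulrCA [in RHS]mulr_sumr.
Qed.

(** Krylov-Bogolyubov, with an ultralimit of Cesaro means along the orbit. *)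
Lemma inv_prob_exists w : exists mu, inv_prob_on phi (orbit_closure phi w) mu.
Proof.
have erg := @cesaro_ergodic succn (fun _ => 0%N) (fun k => ltnSn k).
have [G [GU tG]] := ultraFilterLemma (tails_proper leq_directed).
by eexists; exact: (ultralimit_inv_prob hT cphi leq_directed erg w GU tG).
Qed.

(** Each function has a subsequence of Cesaro means converging pointwise; diagonalizing over the
    countable family [e] gives one subsequence for its span, and density extends this to every
    [x]. *)
Lemma convergent_ergodic_sequence : tame R phi ->
  exists Va : nat -> ((T -> R) -> R) -> ((T -> R) -> R),
    ergodic_net phi (fun m n : nat => (m <= n)%N) Va /\
    WSO_cvg (fun m n : nat => (m <= n)%N) Va.
Proof.
move=> htame; have [e [ce dense]] := countable_dense_span hT.
pose y x k t := cesaro k.+1 0 (fun z => z t) x.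
have hull x k : inX x -> orbit_hull phi x (y x k).
  by move=> cx; apply: in_coV_hull => //; exact: cesaro_coV.
pose conv x B := forall s, cvg (y x ^~ s @ within B \oo).
pose P j B := if unpickle j is Some (n, i) then conv (e n i) B else True.
have convS x A B : almost_sub A B -> conv x B -> conv x A.
  move=> [n hn] cB s; have /cvg_ex[l hl] := cB s; apply/cvg_ex; exists l.
  apply: cvg_trans hl => S [m _ hm]; exists (maxn n m) => // k /= nmk Ak.
  have nk : (n <= k)%N by apply: leq_trans nmk; exact: leq_maxl.
  apply: hm; last exact: hn.
  by apply: leq_trans nmk; exact: leq_maxr.
have [j A B AB|j A uA|B [uB _ PB]] := @unbounded_diagonal P _ _ setT
    (fun n => ex_intro2 _ _ n (leqnn n) I).
- by rewrite /P; case: unpickle => [[n i]|]; [exact: convS|].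
- rewrite /P; case: unpickle => [[n i]|]; last by exists A; split.
  by apply: orbit_hull_convergent_subset => // k; exact: hull.
have FB := within_unbounded_proper uB.
have convB x : inX x -> conv x B.
  move=> cx s; apply/cauchy_cvgP/cauchy_exP => d d0.
  have d3 : 0 < d / 3 by rewrite divr_gt0.
  have [n [m [c hc]]] := dense x _ cx d3.
  have ex i : exists l : R, y (e n i) ^~ s @ within B \oo --> l.
    have := PB (pickle (n, i)); rewrite /P pickleK => cv.
    by have /cvg_ex[l hl] := cv s; exists l.
  have [l hl] := choice ex.
  have lim_comb : (fun k => \sum_(i < m) c i * y (e n i) k s) @ within B \oo -->
      \sum_(i < m) c i * l i.
    elim: (m) => [|m' IH].
      rewrite big_ord0 (_ : (fun k => _) = fun _ => 0); first exact: cvg_cst.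
      by apply/funext => k; rewrite big_ord0.
    rewrite big_ord_recr/= (_ : (fun k => _) = fun k =>
        \sum_(i < m') c i * y (e n i) k s + c m' * y (e n m') k s).
      by apply: cvgD IH _; apply: cvgM; [exact: cvg_cst|exact: hl].
    by apply/funext => k; rewrite big_ord_recr.
  exists (\sum_(i < m) c i * l i).
  have /cvgrPdist_lt/(_ _ d3) := lim_comb; apply: filterS => k hk.
  rewrite /ball/=.
  apply: le_lt_trans (ler_distD (\sum_(i < m) c i * y (e n i) k s) _ _) _.
  have := @cesaro_Dirac_dist k.+1 0 s _ _ _ isT hc.
  rewrite cesaro_Dirac_sum => hd; rewrite [X in _ + X]distrC; rewrite /y in hk *; lra.
(* [u] may repeat elements of [B]; [k <= u k] suffices for convergence and for ergodicity. *)
have exu n : exists m, (n <= m)%N /\ B m by have [m] := uB n; exists m.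
have [u hu] := choice exu.
exists (fun k => cesaro (u k).+1 0).
have erg : ergodic_net phi (fun m n : nat => (m <= n)%N) (fun k => cesaro (u k).+1 0).
  apply: (@cesaro_ergodic (fun k => (u k).+1) (fun _ => 0%N)) => k.
  by rewrite ltnS; case: (hu k).
split=> //; apply: (WSO_cvg_of_Dirac hT cphi leq_directed erg htame) => x t cx.
have /cvg_ex[l hl] := convB x cx t; apply/cvg_ex; exists l.
move=> S /hl [n _ hn]; exists n => // k /= nk; have [ku Bu] := hu k.
by apply: hn => //=; exact: leq_trans ku.
Qed.

End Cesaro.

(** * Minimal sets, and orbit closures that contain only one *)

Section MinimalSets.
Variables (R : realType) (T : metricType R) (phi : T -> T).
Hypothesis hT : compact [set: T].
Hypothesis cphi : continuous phi.
Implicit Types (x y : T -> R) (K M : set T).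

Lemma orbit_closure_iter w n : orbit_closure phi w (iter n phi w).
Proof. by apply: subset_closure; exists n. Qed.

Lemma invariant_iter K t n : invariant_set phi K -> K t -> K (iter n phi t).
Proof. by move=> iK Kt; elim: n => // n IH; apply: iK; exists (iter n phi t). Qed.

Lemma orbit_closure_sub K w : closed K -> invariant_set phi K -> K w ->
  orbit_closure phi w `<=` K.
Proof.
move=> clK iK Kw; rewrite /orbit_closure (closure_id K).1//.
by apply: closure_subset => _ [n _ <-]; exact: invariant_iter.
Qed.

Lemma orbit_closure_invariant w : invariant_set phi (orbit_closure phi w).
Proof.
move=> _ [t wt <-] B /(@cphi t) /wt [_ [[n _ <-] Bn]].
by exists (phi (iter n phi w)); split=> //; exists n.+1.
Qed.

(** Zorn's lemma on complements: a maximal open set whose removal leaves a nonempty invariant part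
    of [K]. Compactness keeps intersections along chains nonempty. *)
Lemma minimal_subset K : K !=set0 -> closed K -> invariant_set phi K ->
  exists2 M, M `<=` K & minimal_set phi M.
Proof.
move=> K0 clK iK.
pose P A := [/\ open A, (K `\` A) !=set0 & forall t, K t -> ~ A t -> ~ A (phi t)].
have clD A : open A -> closed (K `\` A).
  by move=> oA; rewrite setDE; apply: closedI => //; exact: open_closedC.
have [F FP tot|A [[oA [t0 [Kt0 At0]] iA] maxA]] := @Zorn_bigcup T P.
  split.
  - by apply: bigcup_open => A /FP[].
  - have [[A0 FA0]|F0] := pselect (exists A, F A); last first.
      have [t Kt] := K0; exists t; split=> // -[A FA _].
      by apply: F0; exists A.
    have FF : ProperFilter (filter_from F (fun A => K `\` A)).
      apply: filter_from_proper; last by move=> A /FP[].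
      apply: filter_from_filter; first by exists A0.
      move=> A B FA FB; have [AB|BA] := tot A B FA FB.
        by exists B => // t [Kt Bt]; split; split=> // /AB.
      by exists A => // t [Kt At]; split; split=> // /BA.
    have [p [_ clp]] := hT FF filterT.
    have pKA A : F A -> (K `\` A) p.
      move=> FA; have cl : closed (K `\` A).
        by apply: clD; have [] := FP A FA.
      apply: cl => B Bp.
      by apply: clp => //; exists A.
    exists p; split; first by have [] := pKA A0 FA0.
    by move=> [A FA Ap]; have [_] := pKA A FA.
  - move=> t Kt nF [A FA Aphi]; have [_ _ iA] := FP A FA.
    by apply: (iA t Kt) Aphi => At; apply: nF; exists A.
exists (K `\` A); first by move=> t [].
split; [by exists t0|split; [exact: clD|split]].
  by move=> _ [t [Kt At] <-]; split; [apply: iK; exists t|exact: iA].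
move=> M MK M0 clM iM; apply/seteqP; split=> // t [Kt At].
apply: contrapT => nMt; apply: (maxA (~` M)).
  split; first by move=> s As Ms; have [_] := MK s Ms.
  by move=> /(_ t nMt).
split; first exact: closed_openC.
  by have [m Mm] := M0; exists m; split; [have [] := MK m Mm|apply].
by move=> s Ks nMs nMphi; apply: nMphi; apply: iM; exists s => //; exact: contrapT.
Qed.

Lemma zero_set_function K : closed K -> K !=set0 ->
  exists2 z : T -> R, cpos z & forall t, z t = 0 <-> K t.
Proof.
move=> clK [k0 Kk0]; pose z t := inf [set mdist s t | s in K].
have hE t : has_inf [set mdist s t | s in K].
  by split; [exists (mdist k0 t), k0|exists 0 => _ [s _ <-]; exact: mdist_ge0].
have z0 t : 0 <= z t.
  by apply: lb_le_inf; [case: (hE t)|move=> _ [s _ <-]; exact: mdist_ge0].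
have lip t s : z t - z s <= mdist s t.
  rewrite lerBlDl -lerBlDr; apply: lb_le_inf; first by case: (hE s).
  move=> _ [u Ku <-]; rewrite lerBlDr.
  apply: le_trans (metric_triangle u s t); apply: ge_inf.
    by case: (hE t).
  by exists u.
exists z => [|t]; first split=> // t.
  apply/cvgrPdist_lt => e e0; have := nbhsx_ballx t _ e0; rewrite ballEmdist.
  apply: filterS => s /= ts; rewrite ltr_norml; apply/andP; split.
    by have := lip s t; lra.
  by have := lip t s; rewrite metric_sym; lra.
split=> [zt|Kt]; last first.
  apply/eqP; rewrite eq_le z0 andbT; apply: ge_inf; first by case: (hE t).
  by exists t => //; exact: mdistxx.
apply: clK => B; rewrite -nbhs_ballE => -[r /= r0].
rewrite ballEmdist => hr; have [_ [s Ks <-]] := inf_adherent r0 (hE t).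
by rewrite -/(z t) zt add0r metric_sym => st; exists s; split=> //; exact: hr.
Qed.

(** Cover by the set [g < e] at zeros of [z] and, at any other point, by the set where [z] exceeds
    half its value there; finitely many of these half values give [d]. *)
Lemma zero_set_control (z g : T -> R) (e : R) : cpos z -> cpos g ->
  (forall t, z t = 0 -> g t = 0) -> 0 < e ->
  exists2 d, 0 < d & forall t, z t < d -> g t < e.
Proof.
move=> [cz z0] [cg g0] zg e0.
pose O t : set T := if z t == 0 then [set s | g s < e] else [set s | z t / 2 < z s].
have [t|t|l hl] := compact_seq_cover hT (O := O).
- by rewrite /O; case: eqP => _; [exact: open_lt|exact: open_gt].
- rewrite /O; case: eqP => [/zg /= ->//|/eqP zt /=].
  by have : 0 < z t; [rewrite lt_neqAle eq_sym zt z0|lra].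
have [d d0 hd] : exists2 d : R, 0 < d & forall t, t \in l -> z t != 0 -> d <= z t / 2.
  elim: (l) => [|t l' [d d0 hd]]; first by exists 1.
  have [zt|zt] := eqVneq (z t) 0.
    exists d => // s; rewrite inE => /orP[/eqP ->|/hd//].
    by rewrite zt eqxx.
  exists (Num.min (z t / 2) d).
    by rewrite lt_min d0 andbT divr_gt0// lt_neqAle eq_sym zt z0.
  move=> s; rewrite inE ge_min => /orP[/eqP -> _|/hd h /h ->]; first by rewrite lexx.
  by rewrite orbT.
exists d => // s zs; have [t tl] := hl s; rewrite /O; case: eqP => [//|/eqP zt /= ts].
by have := hd t tl zt; lra.
Qed.

Section UniqueMinimal.
Variables (K M : set T) (z : T -> R).
Hypothesis clK : closed K.
Hypothesis iK : invariant_set phi K.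
Hypothesis uniqM : forall M', M' `<=` K -> minimal_set phi M' -> M' = M.
Hypothesis mM : minimal_set phi M.
Hypothesis cz : cpos z.
Hypothesis zM : forall t, z t = 0 <-> M t.

Lemma orbit_approaches_minimal w (e : R) : K w -> 0 < e ->
  exists n, z (iter n phi w) < e.
Proof.
move=> Kw e0; have wK := orbit_closure_sub clK iK Kw.
have [|||M' M'w mM'] := @minimal_subset (orbit_closure phi w).
- by exists w; exact: (@orbit_closure_iter w 0%N).
- exact: closed_closure.
- exact: orbit_closure_invariant.
have MM' : M' = M by apply: uniqM => // t /M'w /wK.
have [[m Mm] _] := mM; rewrite -MM' in Mm.
have zm : z m < e by rewrite (zM m).2 // -MM'.
have [_ [[n _ <-] zn]] := M'w m Mm _ (open_nbhs_nbhs (conj (open_lt e cz.1) zm)).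
by exists n.
Qed.

(** Induction on [E]: times [n m] push [E] towards [M], and a cluster point [p] of the images of [w]
    comes near [M] after [n'] more steps. By invariance of [M], these steps keep the images of [E]
    near [M]. *)
Lemma orbits_approach_minimal (E : seq T) (e : R) :
  (forall w, w \in E -> K w) -> 0 < e ->
  exists n, forall w, w \in E -> z (iter n phi w) < e.
Proof.
elim: E e => [|w E IH] e hE e0; first by exists 0%N.
have KE v : v \in E -> K v by move=> vE; apply: hE; rewrite inE vE orbT.
have ex m : exists n, forall v, v \in E -> z (iter n phi v) < m.+1%:R^-1.
  by apply: IH => //; rewrite invr_gt0.
have [n hn] := choice ex.
have Kw : K w by apply: hE; rewrite inE eqxx.
have [p [_ clp]] := hT
  (fmap_proper_filter (fun m => iter (n m) phi w) eventually_filter) filterT.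
have Kp : K p.
  apply: clK => B Bp; apply: clp => //.
  by exists 0%N => // m _; exact: invariant_iter.
have [n' hn'] := orbit_approaches_minimal Kp e0.
have cg : cpos (fun t => z (iter n' phi t)).
  by split=> [|t]; [apply: inX_iter => //; case: cz|case: cz].
have [t|d d0 hd] := zero_set_control cz cg _ e0.
  by move=> /zM Mt; apply/zM; apply: invariant_iter => //; case: mM => _ [_ []].
have [m0] := ltr_add_invr d0; rewrite add0r => hm0.
have tail : ((fun m => iter (n m) phi w) @ \oo)
    [set s | exists2 m, (m0 <= m)%N & s = iter (n m) phi w].
  by exists m0 => // m /= mm; exists m.
have [_ [[m mm ->] /= hm]] := clp _ _ tail
  (open_nbhs_nbhs (conj (open_lt e cg.1) hn')).
exists (n' + n m)%N => v; rewrite inE iterD => /orP[/eqP -> //|vE].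
apply: hd; apply: lt_trans (hn m v vE) _; apply: le_lt_trans hm0.
by rewrite lef_pV2 ?posrE ?ltr0n// ler_nat.
Qed.

Lemma inv_prob_posf (mu : (T -> R) -> R) : inv_prob_on phi K mu -> posf mu.
Proof.
move=> [hmu [mu0 _]]; split.
- by move=> x y [cx _] [cy _]; exact: (inXstar_add hmu).
- by move=> a x _ [cx _]; exact: (inXstar_scale hmu).
- by move=> x [cx x0]; exact: mu0.
Qed.

Lemma inv_prob_iter (mu : (T -> R) -> R) x n : inv_prob_on phi K mu -> inX x ->
  mu (fun t => x (iter n phi t)) = mu x.
Proof.
move=> [_ [_ [_ [_ inv]]]] cx; elim: n => // n <-.
rewrite -[RHS]inv; last exact: inX_iter.
by rewrite /Vop; congr mu; apply/funext => t; rewrite /= -iterSr.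
Qed.

(** By invariance the iterates of [z] all have integral [mu z], yet they tend to 0 on [K] along a
    filter of times; convergence for nets in the hull forces [mu z = 0]. *)
Lemma inv_prob_minimal_support (mu : (T -> R) -> R) :
  tame R phi -> inv_prob_on phi K mu -> mu z = 0.
Proof.
move=> htame hmu; have hL := inv_prob_posf hmu.
(* [F] is generated by the times that push a given finite subset of [K] into [z < e]; the existence
   of such times makes it proper. *)
pose F : set_system nat := fun A => exists (E : seq T) (e : R),
  [/\ forall w, w \in E -> K w, 0 < e &
  forall n, (forall w, w \in E -> z (iter n phi w) < e) -> A n].
have FF : ProperFilter F.
  split.
    move=> [E [e [EK e0 h]]]; have [n hn] := orbits_approach_minimal EK e0.
    exact: h n hn.
  split; first by exists [::], 1.
  - move=> A B [E [e [EK e0 hA]]] [E' [e' [EK' e0' hB]]].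
    exists (E ++ E'), (Num.min e e'); split.
    + by move=> w; rewrite mem_cat => /orP[/EK|/EK'].
    + by rewrite lt_min e0 e0'.
    move=> n hn; split; [apply: hA|apply: hB] => w wE.
      by have := hn w; rewrite mem_cat wE lt_min => /(_ isT) /andP[].
    by have := hn w; rewrite mem_cat wE orbT lt_min => /(_ isT) /andP[].
  - by move=> A B AB [E [e [EK e0 h]]]; exists E, e; split=> // n /h /AB.
have hull n : orbit_hull phi z (fun t => z (iter n phi t)).
  exists n.+1, (fun k => (k == n)%:R); split.
    rewrite big_ord_recr/= big1 ?eqxx ?normr1 ?add0r ?ler1n// => i _.
    by rewrite ltn_eqF ?normr0.
  apply/funext => t; rewrite big_ord_recr/= big1 ?eqxx ?mul1r ?add0r// => i _.
  by rewrite ltn_eqF ?mul0r.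
have LK y : cpos y -> (forall t, K t -> y t = 0) -> mu y = 0.
  by move=> [cy _]; case: hmu => _ [_ [_ [+ _]]]; apply.
have z0 t : K t -> (fun n => z (iter n phi t)) @ F --> 0.
  move=> Kt; apply/cvgrPdist_lt => e e0; exists [:: t], e; split=> //.
    by move=> w; rewrite inE => /eqP ->.
  move=> n /(_ t); rewrite inE eqxx => /(_ isT).
  by rewrite sub0r normrN ger0_norm//; case: cz.
have := orbit_hull_net_cvg hT cphi htame cz.1 hull hL clK LK FF z0.
rewrite (_ : (fun n => _) = fun _ => mu z).
  move=> h; have E0 : lim ((fun _ : nat => mu z) @ F) = 0 by apply/cvg_lim.
  have E1 : lim ((fun _ : nat => mu z) @ F) = mu z.
    by apply/cvg_lim => //; exact: cvg_cst.
  by rewrite -E1 E0.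
apply/funext => n; rewrite -(inv_prob_iter n hmu cz.1); congr mu.
by apply/funext => t; rewrite ger0_norm//; case: cz.
Qed.

End UniqueMinimal.
End MinimalSets.

(** * The implications between the four conditions *)

Section Equivalences.
Variables (R : realType) (T : metricType R) (phi : T -> T).
Hypothesis hT : compact [set: T].
Hypothesis cphi : continuous phi.
Hypothesis htame : tame R phi.
Implicit Types (x y : T -> R) (mu nu : (T -> R) -> R).

(* [f] is invariant; if it took two values on [M], they would be taken along
   two dense orbits, making the Cesaro means independent along [B]. *)
Lemma cesaro_limit_constant M x B (f : T -> R) : minimal_set phi M -> inX x ->
  unbounded B ->
  (forall t, (fun k => cesaro phi k.+1 0 (fun y => y t) x) @ within B \oo --> f t) ->
  forall s1 s2, M s1 -> M s2 -> f s1 <= f s2.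
Proof.
move=> mM cx uB hf s1 s2 Ms1 Ms2; rewrite leNgt; apply/negP => f21.
have FB := within_unbounded_proper uB.
have [_ [clM [iM minM]]] := mM.
pose y k t := cesaro phi k.+1 0 (fun z => z t) x.
have hull k : orbit_hull phi x (y k).
  by apply: in_coV_hull => //; exact: cesaro_coV.
have cy k : inX (y k) by exact: inX_orbit_hull (hull k).
have finv t : f (phi t) = f t.
  have h : (fun k => y k t - y k (phi t)) @ within B \oo --> f t - f (phi t).
    by apply: cvgB; exact: hf.
  have h0 : (fun k => y k t - y k (phi t)) @ within B \oo --> 0.
    have [_ er] := @cesaro_ergodic _ _ phi hT cphi succn (fun _ => 0%N)
      (fun k => ltnSn k).
    have /(net_cvgP leq_directed) := er x _ cx (inXstar_eval R hT t).
    move=> hc S /hc [n _ hn]; exists n => // k nk _.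
    have := hn k nk; congr S; rewrite /y /Vop /cesaro/=; congr (_ - _ * _).
    by apply: eq_bigr => i _; rewrite -iterS iterSr.
  have E0 : lim ((fun k => y k t - y k (phi t)) @ within B \oo) = 0 by apply/cvg_lim.
  have E1 : lim ((fun k => y k t - y k (phi t)) @ within B \oo) = f t - f (phi t).
    by apply/cvg_lim.
  by apply/esym/eqP; rewrite -subr_eq0 -E1 E0.
have finvn t n : f (iter n phi t) = f t by elim: n => //= n IH; rewrite finv.
have dense s W : M s -> open W -> (exists2 t, M t & W t) ->
    exists2 n, M (iter n phi s) & W (iter n phi s).
  move=> Ms oW [t Mt Wt].
  have E : orbit_closure phi s = M.
    apply: minM; first exact: orbit_closure_sub.
    - by exists s; exact: (@orbit_closure_iter _ _ phi s 0%N).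
    - exact: closed_closure.
    - exact: orbit_closure_invariant.
  rewrite -E in Mt; have [_ [[n _ <-] Wn]] := Mt _ (open_nbhs_nbhs (conj oW Wt)).
  by exists n => //; exact: invariant_iter.
pose d := (f s1 - f s2) / 3.
have d0 : 0 < d by rewrite divr_gt0// subr_gt0.
(* An open set meeting [M] contains points of both orbits, where [f] equals [f s1] and [f s2];
   either inequality can thus be imposed on it. *)
pose good W := open W /\ exists2 t, M t & W t.
have goodT : good setT by split; [exact: openT|exists s1].
have good_ne W : good W -> W !=set0 by move=> [_ [t _ Wt]]; exists t.
have goodU W : good W -> \forall k \near within B \oo,
    good (W `&` [set t | f s2 + 2 * d < y k t]).
  move=> [oW meetW]; have [n Mn Wn] := dense s1 W Ms1 oW meetW.
  have lt : f s2 + 2 * d < f (iter n phi s1) by rewrite finvn /d; lra.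
  apply: filterS (cvgr_gt _ (hf (iter n phi s1)) _ lt) => k hk.
  split; last by exists (iter n phi s1).
  by apply: openI => //; exact: open_gt.
have goodV W : good W -> \forall k \near within B \oo,
    good (W `&` [set t | y k t < f s2 + d]).
  move=> [oW meetW]; have [n Mn Wn] := dense s2 W Ms2 oW meetW.
  have lt : f (iter n phi s2) < f s2 + d by rewrite finvn; lra.
  apply: filterS (cvgr_lt _ (hf (iter n phi s2)) _ lt) => k hk.
  split; last by exists (iter n phi s2).
  by apply: openI => //; exact: open_lt.
have hQ (i : nat) : \forall j \near within B \oo, True by exact: filterT.
have [u [_ hu]] := independent_sequence FB goodT good_ne goodU goodV hQ.
have dd : f s2 + d < f s2 + 2 * d by lra.
exact: (orbit_hull_not_indep hT cphi htame cx dd (fun k => hull (u k)) hu).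
Qed.

(** An invariant [mu] gives every mean [y k] the integral [mu x]. It lives on [M], where [y k] tends
    along [B] to the constant [f m0], so [mu x = f m0] whatever [mu]. *)
Lemma unique_minimal_uniquely_ergodic w M :
  M `<=` orbit_closure phi w -> minimal_set phi M ->
  (forall M', M' `<=` orbit_closure phi w -> minimal_set phi M' -> M' = M) ->
  uniquely_ergodic_on R phi (orbit_closure phi w).
Proof.
move=> MK mM uniqM; split; first exact: inv_prob_exists.
set K := orbit_closure phi w in MK uniqM *.
have clK : closed K by exact: closed_closure.
have iK : invariant_set phi K by exact: orbit_closure_invariant.
have [[m0 Mm0] [clM _]] := mM.
have [z cz zM] := zero_set_function clM (ex_intro _ m0 Mm0).
suff val mu x B (f : T -> R) : inv_prob_on phi K mu -> inX x -> unbounded B ->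
    (forall t, (fun k => cesaro phi k.+1 0 (fun y => y t) x) @ within B \oo --> f t) ->
    mu x = f m0.
  move=> mu nu hmu hnu x cx.
  have hull k : orbit_hull phi x (fun t => cesaro phi k.+1 0 (fun y => y t) x).
    by apply: in_coV_hull => //; exact: cesaro_coV.
  have [B [uB _ cB]] := orbit_hull_convergent_subset hT cphi htame cx hull
    (fun n => ex_intro2 _ _ n (leqnn n) I : exists2 m, (n <= m)%N & setT m).
  have ex t : exists l : R,
      (fun k => cesaro phi k.+1 0 (fun y => y t) x) @ within B \oo --> l.
    by have /cvg_ex[l hl] := cB t; exists l.
  have [f hf] := choice ex.
  by rewrite (val mu x B f)// (val nu x B f).
move=> hmu cx uB hf; have hL := inv_prob_posf hmu.
have zmu := inv_prob_minimal_support hT cphi clK iK uniqM mM cz zM htame hmu.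
pose y k t := cesaro phi k.+1 0 (fun z => z t) x.
have hull k : orbit_hull phi x (y k).
  by apply: in_coV_hull => //; exact: cesaro_coV.
have cy k : inX (y k) by exact: inX_orbit_hull (hull k).
have muy k : mu (y k) = mu x.
  have [N [c [_ _ _ <-]]] := in_coV_eval hT cphi (@cesaro_coV R T phi k.+1 0 isT) cx;
    last by case: hmu.
  rewrite /cesaro (eq_bigr (fun _ => mu x)); last first.
    by move=> n _; rewrite (inv_prob_iter cphi _ hmu cx).
  by rewrite sumr_const card_ord -[mu x *+ _]mulr_natl mulKf// pnatr_eq0.
have fc t : M t -> f t = f m0.
  move=> Mt; apply/eqP; rewrite eq_le.
  by rewrite !(cesaro_limit_constant mM cx uB hf).
have [c c0 xc] := inX_bounded hT cx.
pose C := 2 * c + `|f m0|.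
have C0 : 0 <= C by rewrite addr_ge0// mulr_ge0.
have yC k t : `|y k t - f m0| <= C.
  apply: le_trans (ler_normB _ _) _; apply: lerD => //.
  exact: (orbit_hull_bound xc (hull k)).
have exu n : exists m, (n <= m)%N /\ B m by have [m] := uB n; exists m.
have [u hu] := choice exu.
(* [g] tends to 0 everywhere: off [M] because the subtracted term grows, on [M] because the means
   converge. The subtracted term has integral 0 since [mu z = 0]. *)
pose g k t := Num.max 0 (`|y (u k) t - f m0| - k%:R * z t).
have cyc k : inX (fun t => y k t - f m0) by apply: inX_sub => //; exact: inX_cst.
have ckz k : cpos (fun t => k%:R * z t) by exact: cpos_scale.
have cg k : cpos (g k).
  apply: cpos_max; first exact: cpos_cst.
  by apply: inX_sub; [exact: inX_abs|case: (ckz k)].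
have [z0 cz1] : (forall t, 0 <= z t) /\ inX z by case: cz.
have g0 t e : 0 < e -> exists n, forall k, (n <= k)%N -> g k t < e.
  move=> e0; have [zt|zt] := eqVneq (z t) 0.
    have /cvgrPdist_lt/(_ e e0)[n _ hn] := hf t.
    exists n => k nk; rewrite /g zt mulr0 subr0 max_r// -(fc t ((zM t).1 zt)).
    have [ku Bu] := hu k; rewrite distrC; apply: hn => //=.
    exact: leq_trans ku.
  have zt0 : 0 < z t by rewrite lt_neqAle eq_sym zt z0.
  exists (Num.truncn (C / z t)).+1 => k kn; rewrite /g max_l// subr_le0.
  apply: le_trans (yC _ _) _; rewrite -ler_pdivrMr//.
  apply: ltW; apply: lt_le_trans (truncnS_gt _) _.
  by rewrite ler_nat.
have gC k t : g k t <= C.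
  rewrite /g ge_max C0/= lerBlDr; apply: le_trans (yC _ _) _.
  by rewrite lerDl mulr_ge0.
apply/eqP; rewrite -subr_eq0 -normr_le0 leNgt; apply/negP => e0.
have [n hn] := bounded_convergence hT hL cg gC g0 e0.
have := hn n (leqnn n); rewrite ltNge => /negP; apply.
have [hX [_ [mu1 _]]] := hmu.
have -> : mu x - f m0 = mu (fun t => y (u n) t - f m0).
  rewrite (inXstar_sub hX)//; last exact: inX_cst.
  rewrite muy (_ : (fun _ : T => f m0) = fun t => f m0 * (fun _ => 1) t).
    by rewrite (inXstar_scale hX) ?mu1 ?mulr1//; exact: inX_cst.
  by apply/funext => t; rewrite mulr1.
have muabs v : inX v -> `|mu v| <= mu (fun t => `|v t|).
  move=> cv; have ca := cpos_abs cv; have [_ [mu0 _]] := hmu.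
  rewrite ler_norml; apply/andP; split.
    rewrite -subr_ge0 opprK -(inXstar_add hX)//; last by case: ca.
    apply: mu0; first by apply: inX_add => //; case: ca.
    by move=> t; rewrite -lerBlDr sub0r lerNl ler_normr lexx orbT.
  rewrite -subr_ge0 -(inXstar_sub hX)//; last by case: ca.
  apply: mu0; first by apply: inX_sub => //; case: ca.
  by move=> t; rewrite subr_ge0 ler_norm.
apply: le_trans (muabs _ (cyc _)) _.
have -> : mu (g n) = mu (fun t => g n t + n%:R * z t).
  case: (hL) => LD LZ _; rewrite LD// LZ// zmu mulr0 addr0//.
apply: posf_le => //; [exact: cpos_abs|exact: cpos_add|move=> t].
by rewrite -lerBlDr le_max lexx orbT.
Qed.

(** Two minimal sets that meet both equal their intersection. Disjoint ones each carry an invariant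
    probability, and a function separating them has integrals 0 and 1. *)
Lemma uniquely_ergodic_unique_minimal w :
  uniquely_ergodic_on R phi (orbit_closure phi w) ->
  exists M : set T, (M `<=` orbit_closure phi w /\ minimal_set phi M) /\
    forall M', M' `<=` orbit_closure phi w -> minimal_set phi M' -> M' = M.
Proof.
move=> [_ uniq]; set K := orbit_closure phi w in uniq *.
have [|||M MK mM] := @minimal_subset _ _ phi hT K.
- by exists w; exact: (@orbit_closure_iter _ _ phi w 0%N).
- exact: closed_closure.
- exact: orbit_closure_invariant.
exists M; split=> // M' M'K mM'.
have onK M1 : M1 `<=` K -> minimal_set phi M1 -> exists2 mu, inv_prob_on phi K mu &
    forall x, inX x -> (forall t, M1 t -> x t = 0) -> mu x = 0.
  move=> M1K [[t Mt] [clM1 [iM1 _]]].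
  have [mu [hX [mu0 [mu1 [supp inv]]]]] := @inv_prob_exists R _ _ hT cphi t.
  have sub := orbit_closure_sub clM1 iM1 Mt.
  exists mu => [|x cx xM1]; last by apply: supp => // s /sub; exact: xM1.
  split=> //; split=> //; split=> //; split=> // x cx xK.
  by apply: supp => // s /sub /M1K; exact: xK.
have [[s [Ms M's]]|disj] := pselect ((M `&` M') !=set0).
  have [_ [clM [iM minM]]] := mM; have [_ [clM' [iM' minM']]] := mM'.
  have I0 : (M `&` M') !=set0 by exists s.
  have clI : closed (M `&` M') by exact: closedI.
  have iI : invariant_set phi (M `&` M').
    by move=> _ [t [Mt M't] <-]; split; [apply: iM; exists t|apply: iM'; exists t].
  rewrite -(minM _ (@subIsetl _ M M') I0 clI iI).
  by rewrite -{1}(minM' _ (@subIsetr _ M M') I0 clI iI).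
have [mu hmu muM] := onK M MK mM; have [nu hnu nuM'] := onK M' M'K mM'.
have [M0 [clM _]] := mM; have [M'0 [clM' _]] := mM'.
have [z cz zM] := zero_set_function clM M0.
have [z' cz' zM'] := zero_set_function clM' M'0.
have zz t : 0 < z t + z' t.
  have := cz.2 t; have := cz'.2 t; rewrite !le_eqVlt => /orP[/eqP z'0|z'0].
    case/orP => [/eqP z0|z0]; last by rewrite -z'0 addr0.
    by case: disj; exists t; split; [apply/zM|apply/zM'].
  by move=> _; apply: ltr_wpDl => //; case: cz.
(* A Urysohn function, 0 on [M] and 1 on [M']. *)
pose x t := z t / (z t + z' t).
have cx : inX x.
  move=> t; apply: cvgM (cz.1 t) _; apply: cvgV; first by rewrite gt_eqF.
  have cs := inX_add cz.1 cz'.1; exact: cs.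
have mux : mu x = 0.
  by apply: muM => // t /zM zt; rewrite /x zt mul0r.
have : nu (fun t => x t - 1) = 0.
  apply: nuM' => [|t /zM' zt]; first by apply: inX_sub => //; exact: inX_cst.
  by rewrite /x zt addr0 divff ?subrr//; have := zz t; rewrite zt addr0 => /gt_eqF ->.
have [hX [_ [nu1 _]]] := hnu.
rewrite (inXstar_sub hX)//; last exact: inX_cst.
by rewrite -(uniq mu nu hmu hnu x cx) mux nu1 sub0r => /eqP; rewrite oppr_eq0 oner_eq0.
Qed.

(** Every ultralimit of the net at a Dirac functional is an invariant probability on the orbit
    closure, hence agrees with [nu]; common ultralimits mean convergence. *)
Lemma uniquely_ergodic_net_cvg (D : Type) (le : D -> D -> Prop)
    (Va : D -> ((T -> R) -> R) -> ((T -> R) -> R)) :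
  (forall w, uniquely_ergodic_on R phi (orbit_closure phi w)) ->
  directed le -> ergodic_net phi le Va -> WSO_cvg le Va.
Proof.
move=> hB dir erg; apply: (WSO_cvg_of_Dirac hT cphi dir erg htame) => x t cx.
have FF := tails_proper dir.
have [[nu hnu] uniq] := hB t.
have [coV _] := erg.
apply/cvg_ex; exists (nu x); apply: ultra_cvg => G GU tG.
have hG := ultralimit_inv_prob hT cphi dir erg t GU tG.
rewrite -(uniq _ _ hG hnu x cx); apply: (@ultra_bounded_cvg _ _ _ _ (supnorm x)) => i.
rewrite -[leRHS]mul1r; apply: in_coV_bound => //; first exact: inXstar_eval.
by move=> y cy; rewrite mul1r; exact: le_supnorm.
Qed.

(** The negative part of [x - a] vanishes on [K], so only the positive part contributes. *)
Lemma inv_prob_ge mu K x (a : R) : inv_prob_on phi K mu -> inX x ->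
  (forall t, K t -> a <= x t) -> a <= mu x.
Proof.
move=> [hX [mu0 [mu1 [supp _]]]] cx ax.
have c1 : inX (fun _ : T => 1 : R) by exact: inX_cst.
have cd : inX (fun t => x t - a) by apply: inX_sub => //; exact: inX_cst.
have cp : inX (fun t => Num.max 0 (x t - a)) by apply: inX_max => //; exact: inX_cst.
have cm : inX (fun t => Num.min 0 (x t - a)) by apply: inX_min => //; exact: inX_cst.
have xE : x = fun t => a * 1 + (Num.max 0 (x t - a) + Num.min 0 (x t - a)).
  by apply/funext => t; rewrite addr_max_min; ring.
have ca1 : inX (fun _ : T => a * 1) by exact: inX_cst.
rewrite [x]xE (inXstar_add hX)//; last exact: inX_add.
rewrite (inXstar_add hX cp cm) (supp _ cm) ?addr0; last first.
  by move=> t /ax h; rewrite min_l// subr_ge0.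
rewrite (inXstar_scale hX a c1) mu1 mulr1 lerDl; apply: mu0 => // t.
by rewrite le_max lexx.
Qed.

(** Since [y k] has integral [mu x], it drops below [mu x + d] on the orbit closure and,
    inequalities being closed, on the orbit itself. Its value at time [p] is the mean over the
    window starting at [p]; likewise for [nu], so the windows can alternate. *)
Lemma sequences_cvg_uniquely_ergodic :
  (forall Va : nat -> ((T -> R) -> R) -> ((T -> R) -> R),
     ergodic_net phi (fun m n : nat => (m <= n)%N) Va ->
     WSO_cvg (fun m n : nat => (m <= n)%N) Va) ->
  forall w, uniquely_ergodic_on R phi (orbit_closure phi w).
Proof.
move=> hC w; split; first exact: inv_prob_exists.
suff nlt mu nu x : inv_prob_on phi (orbit_closure phi w) mu ->
    inv_prob_on phi (orbit_closure phi w) nu -> inX x -> ~ (mu x < nu x).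
  move=> mu nu hmu hnu x cx; apply/eqP; rewrite eq_le !leNgt.
  by apply/andP; split; apply/negP; exact: nlt.
move=> hmu hnu cx lt; pose d := (nu x - mu x) / 3.
have d0 : 0 < d by rewrite divr_gt0// subr_gt0.
pose y k t := cesaro phi k.+1 0 (fun z => z t) x.
have cy k : inX (y k).
  apply: (inX_orbit_hull cphi cx); apply: in_coV_hull => //; exact: cesaro_coV.
have inv k m : inv_prob_on phi (orbit_closure phi w) m -> m (y k) = m x.
  move=> hm.
  have [N [c [_ _ _ <-]]] := in_coV_eval hT cphi (@cesaro_coV R T phi k.+1 0 isT) cx;
    last by case: hm.
  rewrite /cesaro (eq_bigr (fun _ => m x)); last first.
    by move=> n _; rewrite (inv_prob_iter cphi _ hm cx).
  by rewrite sumr_const card_ord -[m x *+ _]mulr_natl mulKf// pnatr_eq0.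
have low k : exists p, y k (iter p phi w) < mu x + d.
  apply: contrapT => no.
  have : mu x + d <= mu (y k).
    apply: (inv_prob_ge hmu) => // t.
    move=> Kt; apply: (closed_ge (cy k)); apply: closure_subset Kt => _ [p _ <-] /=.
    by rewrite leNgt; apply/negP => h; apply: no; exists p.
  by rewrite inv//; lra.
have high k : exists p, nu x - d < y k (iter p phi w).
  apply: contrapT => no; have [hX _] := hnu.
  have cyN : inX (fun t => -1 * y k t) by exact: inX_scale.
  have : - (nu x - d) <= nu (fun t => -1 * y k t).
    apply: (inv_prob_ge hnu) => // t.
    move=> Kt; apply: (closed_ge cyN); apply: closure_subset Kt => _ [p _ <-] /=.
    by rewrite mulN1r lerN2 leNgt; apply/negP => h; apply: no; exists p.
  by rewrite (inXstar_scale hX)// mulN1r lerN2 inv//; lra.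
have [pl hl] := choice low; have [ph hh] := choice high.
pose p k := if odd k then ph k else pl k.
have erg := @cesaro_ergodic _ _ phi hT cphi succn p (fun k => ltnSn k).
have [A [_ cv]] := hC _ erg.
have d2 : 0 < d / 2 by rewrite divr_gt0.
have [n hn] := cv x _ cx (inXstar_eval R hT w) _ d2.
have yE k : cesaro phi k.+1 (p k) (fun z => z w) x = y k (iter (p k) phi w).
  rewrite /y /cesaro; congr (_ * _); apply: eq_bigr => i _.
  by rewrite add0n addnC iterD.
(* One even and one odd index past [n]: their means differ by more than [d], though both lie within
   [d / 2] of the limit. *)
have n2 : (n <= n.*2)%N by rewrite -addnn leq_addr.
have := hn n.*2 n2; have := hn n.*2.+1 (leqW n2).
rewrite !yE {1 2}/p oddS odd_double/=.
have := hl n.*2; have := hh n.*2.+1.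
rewrite !ltr_norml => h1 h2 /andP[h3 h4] /andP[h5 h6].
have dE : d * 3 = nu x - mu x by rewrite /d divfK.
lra.
Qed.


End Equivalences.

Theorem theorem3p4 (R : realType) (T : metricType R) (phi : T -> T) :
  compact [set: T] -> continuous phi -> tame R phi ->
  (exists Va : nat -> ((T -> R) -> R) -> ((T -> R) -> R),
      ergodic_net phi (fun m n : nat => (m <= n)%N) Va /\
      WSO_cvg (fun m n : nat => (m <= n)%N) Va) /\
  let A := forall (D : Type) (le : D -> D -> Prop)
             (Va : D -> ((T -> R) -> R) -> ((T -> R) -> R)),
             directed le -> ergodic_net phi le Va -> WSO_cvg le Va in
  let B := forall w : T, uniquely_ergodic_on R phi (orbit_closure phi w) in
  let C := forall Va : nat -> ((T -> R) -> R) -> ((T -> R) -> R),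
             ergodic_net phi (fun m n : nat => (m <= n)%N) Va ->
             WSO_cvg (fun m n : nat => (m <= n)%N) Va in
  let D := forall w : T, exists M : set T,
             (M `<=` orbit_closure phi w /\ minimal_set phi M) /\
             forall M', M' `<=` orbit_closure phi w -> minimal_set phi M' -> M' = M in
  (A <-> B) /\ (B <-> C) /\ (C <-> D).
Proof.
move=> hT cphi htame; split; first exact: convergent_ergodic_sequence.
move=> A B C D.
have AC : A -> C by move=> hA Va; exact: hA leq_directed.
have CB : C -> B by exact: sequences_cvg_uniquely_ergodic.
have BA : B -> A.
  move=> hB I le Va dir erg.
  exact: (uniquely_ergodic_net_cvg hT cphi htame hB dir erg).
have BD : B -> D by move=> hB w; exact: uniquely_ergodic_unique_minimal.
have DB : D -> B.
  move=> hD w; have [M [[MK mM] uniqM]] := hD w.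
  exact: (unique_minimal_uniquely_ergodic hT cphi htame MK mM uniqM).
split; [by split=> [/AC/CB|]|split; first by split=> [/BA/AC|]].
by split=> [/CB/BD|/DB/BA/AC].
Qed.
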